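(* Let $0<\alpha<1$, $0<\tau<1$, and for $t>0$ let $k_{t}(\nu) = t^{\frac{1}{1+\alpha}}K_{+}\bigl(t+\nu t^{\frac{1}{1+\alpha}}, t\bigr)$, $\nu\in\mathbb{R}$. There exists a function $k_{\infty}(\nu)$ with the property that $k_{t}(\nu) \to k_{\infty}(\nu)$ as $t\to\infty$, locally uniformly in $\nu\in\mathbb{R}$. The function $k_{\infty}$ has the representation $$k_{\infty}(\nu) = \frac{1}{4\pi}\int_{-\infty}^{\infty}\exp\Bigl(\frac{1-\tau}{2}(\mathrm{i} w)^{1+\alpha} - \mathrm{i} \nu w\Bigr)\,dw .$$ Also, $\partial_{\nu}^{n}k_{t}(\nu) \to k^{(n)}_{\infty}(\nu)$ as $t\to\infty$, locally uniformly in $\nu$, for every $n\in \mathbb{N}$.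
   Context: The fractional Zener wave operator is $$P = \frac{\partial^2}{\partial t^2} - \mathcal{L}^{-1}_{s\to t}\Bigl(\frac{1+s^{\alpha}}{1+\tau s^{\alpha}}\Bigr) \ast_{t} \frac{\partial^2}{\partial x^2},$$ where $\mathcal{L}^{-1}$ is the inverse Laplace transform, $\ast_t$ is convolution in $t$, and powers use the principal branch. $\mathcal{S}'(\mathbb{R}\times\mathbb{R}_+)$ denotes the space of tempered distributions on $\mathbb{R}^2$ (variables $(x,t)$) vanishing on $\mathbb{R}\times(-\infty,0)$. The fundamental solution $S$ is the unique element of $\mathcal{S}'(\mathbb{R}\times\mathbb{R}_+)$ with $PS=\delta(x)\delta(t)$. Equivalently, its Laplace transform with respect to $t$ is $$\tilde S(x,s)=\frac{1}{2s}\,l_\alpha(s)\exp\bigl(-|x|\,s\,l_\alpha(s)\bigr),\quad x\in\mathbb{R},\ \operatorname{Re}s>0,\qquad l_\alpha(s)=\sqrt{\frac{1+\tau s^\alpha}{1+s^\alpha}},$$ with principal branches. Set $K(x,t)=\partial_t S(x,t)$ (the solution with initial conditions $u(x,0)=\delta(x)$, $\partial_tu(x,0)=0$ and zero force), which for $x\ne0$ is given by $K(x,t)=\frac{1}{4\pi \mathrm{i}}\int_{a-\mathrm{i}\infty}^{a+\mathrm{i}\infty}l_\alpha(s)\exp(-|x|sl_\alpha(s)+st)\,ds$, $a>0$. Let $K_+(x,t)=H(x)K(x,t)$ with $H$ the Heaviside function. Powers $(\mathrm{i}w)^{1+\alpha}$ use the principal branch. *)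

(* Defs.v *)
From HB Require Import structures.
From mathcomp Require Export all_boot all_order all_algebra.
From mathcomp Require Export complex.
From mathcomp Require Export all_classical all_reals all_analysis.
Export Order.TTheory GRing.Theory Num.Theory numFieldNormedType.Exports.

Set Implicit Arguments.
Unset Strict Implicit.
Unset Printing Implicit Defensive.

Local Open Scope ring_scope.
Local Open Scope classical_set_scope.
Local Open Scope complex_scope.

Definition cexp (R : realType) (z : R[i]) : R[i] :=
  (expR (complex.Re z))%:C * (cos (complex.Im z) +i* sin (complex.Im z)).

(* Principal argument, in ]-pi, pi]; carg 0 = pi / 2 is a junk value. *)
Definition carg (R : realType) (z : R[i]) : R :=
  (if complex.Im z < 0 then -1 else 1) * acos (complex.Re z / ComplexField.Normc.normc z).

Definition clog (R : realType) (z : R[i]) : R[i] := ln (ComplexField.Normc.normc z) +i* carg z.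

(* Principal branch of [z ^ p]; the value at [z = 0] agrees with [powR]. *)
Definition cpow (R : realType) (z : R[i]) (p : R) : R[i] :=
  if z == 0 then (p == 0)%:R else cexp (p%:C * clog z).

Definition cintegrable (R : realType) (D : set R) (f : R -> R[i]) : Prop :=
  (@lebesgue_measure R).-integrable D (EFin \o (fun x => complex.Re (f x))) /\
  (@lebesgue_measure R).-integrable D (EFin \o (fun x => complex.Im (f x))).

Definition cintegral (R : realType) (D : set R) (f : R -> R[i]) : R[i] :=
  Rintegral (@lebesgue_measure R) D (fun x => complex.Re (f x)) +i*
  Rintegral (@lebesgue_measure R) D (fun x => complex.Im (f x)).

(* [f], vanishing on the negative half-line, has Laplace transform [F] on the
   open right half-plane. *)
Definition has_laplace (R : realType) (f : R -> R) (F : R[i] -> R[i]) : Prop :=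
  forall s : R[i], 0 < complex.Re s ->
    cintegrable `[0, +oo[ (fun t => (f t)%:C * cexp (- (s * t%:C))) /\
    cintegral `[0, +oo[ (fun t => (f t)%:C * cexp (- (s * t%:C))) = F s.

(* [sqrtc] is the square root with nonnegative real part, i.e. the principal
   one. *)
Definition zener_l (R : realType) (alpha tau : R) (s : R[i]) : R[i] :=
  sqrtc ((1 + tau%:C * cpow s alpha) / (1 + cpow s alpha)).

Definition zener_Stilde (R : realType) (alpha tau x : R) (s : R[i]) : R[i] :=
  (2%:R * s)^-1 * zener_l alpha tau s *
  cexp (- (`|x|%:C * s * zener_l alpha tau s)).

(* The fundamental solution [S x t] of the Zener wave operator: the tempered
   distribution supported in [t >= 0] whose Laplace transform in [t] is
   [zener_Stilde]. It is a real-valued function; the Laplace transform fixes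
   [S x] only almost everywhere, so the last clause selects its continuous
   representative. That representative does not exist for [x = 0], where [S]
   jumps at [t = 0]. *)
Definition zener_fundamental_solution (R : realType) (alpha tau : R)
    (S : R -> R -> R) : Prop :=
  [/\ forall x t, t < 0 -> S x t = 0,
      forall x, has_laplace (S x) (zener_Stilde alpha tau x)
    & forall x, x != 0 -> continuous (S x)].

Definition heaviside (R : realType) (x : R) : R := if 0 <= x then 1 else 0.

Definition zener_K (R : realType) (S : R -> R -> R) (x t : R) : R :=
  derive1 (S x) t.

Definition zener_Kplus (R : realType) (S : R -> R -> R) (x t : R) : R :=
  heaviside x * zener_K S x t.

Definition zener_k (R : realType) (alpha : R) (S : R -> R -> R) (t nu : R) : R :=
  t `^ (1 / (1 + alpha)) *
  zener_Kplus S (t + nu * t `^ (1 / (1 + alpha))) t.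

Definition kinf_integrand (R : realType) (alpha tau nu w : R) : R[i] :=
  cexp (((1 - tau) / 2)%:C * cpow ('i%C * w%:C) (1 + alpha) - 'i%C * (nu * w)%:C).

(* Main.v *)
Require Import Defs.
From mathcomp Require Import measurable_realfun ring lra.

(* Inverting the Laplace transform on the line Re s = a, for any a > 0, gives
   K(x,t) as a Bromwich integral. With a = t^-2 and s = t^(-1/(1+alpha)) zeta,
   zeta = eps + i w, it becomes
     k_t(nu) = (4 pi)^-1 int l(s) exp(t s (1 - l(s)) - nu zeta l(s)) dw,
   and s -> 0 as t grows, so that l(s) -> 1 and
   t s (1 - l(s)) -> (1 - tau)/2 (i w)^(1+alpha) for each w. Since
     Re (s l(s)) >= c (Im s)^2 |s|^(alpha-1) / (1 + |s|^alpha)^2,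
   the integrand is dominated by C exp(- c |w|^(1-alpha)), uniformly in t >= 1
   and x >= t/2; each derivative in nu costs a factor of size at most 1 + |w|.
   Dominated convergence then gives pointwise convergence of every derivative,
   and the bound on the next derivative makes the family equi-Lipschitz on
   compact sets, which upgrades this to locally uniform convergence. *)

Set Implicit Arguments.
Unset Strict Implicit.
Unset Printing Implicit Defensive.

Local Open Scope ring_scope.
Local Open Scope classical_set_scope.
Local Open Scope complex_scope.

(** What is given about S(x, .) is the integrability of its damped versions and, for x != 0, its
    continuity; its differentiability is not given. So S is inverted rather than K: Abel summation,
    applied to the integrable function S(x, u) exp(- a u), asks only for continuity at the point and
    integrability of the transform. K is then reached by differentiating the resulting integral in
    time with the contour held fixed.

    The exponent 1 - alpha of the dominating function comes from high frequencies. Here |s| has size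
    t^(-1/(1+alpha)) |w| once |w| >= 1, and the lower bound for t Re (s l(s)) is of order t
    |s|^(1+alpha), that is |w|^(1+alpha), while |s| <= 1, but only of order t |s|^(1-alpha) beyond.
    For t >= 1 and |w| >= 1 both dominate |w|^(1-alpha).

    The condition x >= t/2 holds for x = t + nu t^(1/(1+alpha)) only beyond a threshold in t, which
    is uniform for bounded nu. It also forces x > 0, so that the Heaviside factor is 1 and S(x, .)
    is continuous. *)

Local Notation normc := ComplexField.Normc.normc.
Local Notation Rez := complex.Re.
Local Notation Imz := complex.Im.

(** * The complex exponential and powers *)

Section ComplexFunctions.
Variable R : realType.
Implicit Types (x y z : R[i]) (p q r : R).

Lemma ReM x y : Rez (x * y) = Rez x * Rez y - Imz x * Imz y.
Proof. by case: x y => [a b] [c d]. Qed.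

Lemma ImM x y : Imz (x * y) = Rez x * Imz y + Imz x * Rez y.
Proof. by case: x y => [a b] [c d]. Qed.

Lemma ReD x y : Rez (x + y) = Rez x + Rez y.
Proof. by case: x y => [a b] [c d]. Qed.

Lemma ImD x y : Imz (x + y) = Imz x + Imz y.
Proof. by case: x y => [a b] [c d]. Qed.

Lemma ReN x : Rez (- x) = - Rez x.
Proof. by case: x. Qed.

Lemma ImN x : Imz (- x) = - Imz x.
Proof. by case: x. Qed.

Lemma Re1 : Rez (1 : R[i]) = 1. Proof. by []. Qed.

Lemma Im1 : Imz (1 : R[i]) = 0. Proof. by []. Qed.

Lemma normc_sqr z : normc z ^+ 2 = Rez z ^+ 2 + Imz z ^+ 2.
Proof. by case: z => a b /=; rewrite sqr_sqrtr// addr_ge0// sqr_ge0. Qed.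

Lemma ReV z : Rez z^-1 = Rez z / normc z ^+ 2.
Proof. by rewrite normc_sqr; case: z => a b. Qed.

Lemma ImV z : Imz z^-1 = - (Imz z / normc z ^+ 2).
Proof. by rewrite normc_sqr; case: z => a b. Qed.

Lemma normc_ge0 z : 0 <= normc z.
Proof. by case: z => a b; exact: sqrtr_ge0. Qed.

Lemma normc_eq0 z : (normc z == 0) = (z == 0).
Proof.
apply/eqP/eqP => [/ComplexField.Normc.eq0_normc//|->].
exact: ComplexField.Normc.normc0.
Qed.

Lemma normc_gt0 z : (0 < normc z) = (z != 0).
Proof. by rewrite lt_neqAle normc_ge0 andbT eq_sym normc_eq0. Qed.

Lemma normcM x y : normc (x * y) = normc x * normc y.
Proof. exact: ComplexField.Normc.normcM. Qed.

Lemma normcX x n : normc (x ^+ n) = normc x ^+ n.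
Proof.
elim: n => [|n IH]; first by rewrite !expr0 ComplexField.Normc.normc1.
by rewrite !exprS normcM IH.
Qed.

Lemma normcR r : normc r%:C = `|r|.
Proof. by rewrite /= expr0n addr0 sqrtr_sqr. Qed.

Lemma abs_Re_le z : `|Rez z| <= normc z.
Proof.
rewrite -(ler_pXn2r (_ : (0 < 2)%N))// ?nnegrE ?normc_ge0//.
by rewrite real_normK ?num_real// normc_sqr lerDl sqr_ge0.
Qed.

Lemma abs_Im_le z : `|Imz z| <= normc z.
Proof.
rewrite -(ler_pXn2r (_ : (0 < 2)%N))// ?nnegrE ?normc_ge0//.
by rewrite real_normK ?num_real// normc_sqr lerDr sqr_ge0.
Qed.

Lemma normc_le_ReIm z : normc z <= `|Rez z| + `|Imz z|.
Proof.
rewrite -(ler_pXn2r (_ : (0 < 2)%N))// ?nnegrE ?normc_ge0// ?addr_ge0//.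
rewrite normc_sqr sqrrD !real_normK ?num_real//.
by have : 0 <= `|Rez z| * `|Imz z| by []; lra.
Qed.

Lemma normc_iM r : normc ('i%C * r%:C) = `|r|.
Proof. by rewrite normcM normcR /= expr0n expr1n add0r sqrtr1 mul1r. Qed.

Lemma Re_cexp z : Rez (cexp z) = expR (Rez z) * cos (Imz z).
Proof. by rewrite /cexp ReM /= mul0r subr0. Qed.

Lemma Im_cexp z : Imz (cexp z) = expR (Rez z) * sin (Imz z).
Proof. by rewrite /cexp ImM /= mul0r addr0. Qed.

Lemma eq_ReIm x y : Rez x = Rez y -> Imz x = Imz y -> x = y.
Proof. by case: x y => [a b] [c d] /= -> ->. Qed.

Lemma cexpD x y : cexp (x + y) = cexp x * cexp y.
Proof.
apply: eq_ReIm.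
  rewrite Re_cexp [RHS]ReM !Re_cexp !Im_cexp ReD ImD expRD cosD; ring.
rewrite Im_cexp [RHS]ImM !Re_cexp !Im_cexp ReD ImD expRD sinD; ring.
Qed.

Lemma cexp0 : cexp 0 = 1 :> R[i].
Proof.
by apply: eq_ReIm; rewrite ?Re_cexp ?Im_cexp /= expR0 ?cos0 ?sin0 mul1r.
Qed.

Lemma normc_cexp z : normc (cexp z) = expR (Rez z).
Proof.
rewrite /cexp normcM normcR ger0_norm ?expR_ge0//.
by rewrite /= cos2Dsin2 sqrtr1 mulr1.
Qed.

Lemma Re_div_normc_itv z : -1 <= Rez z / normc z <= 1.
Proof.
have [->|z0] := eqVneq z 0; first by rewrite /= mul0r oppr_le0 !ler01.
have n0 : 0 < normc z by rewrite normc_gt0.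
have /ler_normlP[h1 h2] := abs_Re_le z.
rewrite ler_pdivrMr// mul1r h2 andbT ler_pdivlMr// mulN1r.
by rewrite lerNl.
Qed.

(** There is no exception at [z = 0]: the quotient is 0 there and [carg] is pi / 2. *)
Lemma cos_carg z : cos (carg z) = Rez z / normc z.
Proof.
rewrite /carg; case: ifP => _; rewrite ?mulN1r ?mul1r ?cosN acosK//;
by rewrite in_itv/= Re_div_normc_itv.
Qed.

Lemma sin_carg z : z != 0 -> sin (carg z) = Imz z / normc z.
Proof.
move=> z0; have n0 : normc z != 0 by rewrite normc_eq0.
have -> : sin (carg z) = (if Imz z < 0 then -1 else 1) *
    Num.sqrt (1 - (Rez z / normc z) ^+ 2).
  rewrite /carg; case: ifP => _;
  by rewrite ?mulN1r ?mul1r ?sinN sin_acos ?Re_div_normc_itv.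
have -> : 1 - (Rez z / normc z) ^+ 2 = (Imz z / normc z) ^+ 2.
  have -> : 1 = normc z ^+ 2 / normc z ^+ 2 by rewrite divff// expf_neq0.
  by rewrite !expr_div_n -mulrBl [in LHS](normc_sqr z) addrC addKr -normc_sqr.
rewrite sqrtr_sqr normrM normfV (ger0_norm (normc_ge0 _)) mulrA.
by case: ltrP => [h|h]; rewrite ?(ltr0_norm h) ?(ger0_norm h) ?mulN1r ?opprK ?mul1r.
Qed.

Lemma cexp_clog z : z != 0 -> cexp (clog z) = z.
Proof.
move=> z0; have n0 : normc z != 0 by rewrite normc_eq0.
have lnn : expR (ln (normc z)) = normc z by rewrite lnK// posrE normc_gt0.
apply: eq_ReIm; rewrite ?Re_cexp ?Im_cexp /=.
  by rewrite cos_carg lnn mulrCA divff// mulr1.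
by rewrite sin_carg// lnn mulrCA divff// mulr1.
Qed.

Lemma cpowE z p : z != 0 -> cpow z p = cexp (p%:C * clog z).
Proof. by rewrite /cpow => /negPf->. Qed.

Lemma cpow1 z : z != 0 -> cpow z 1 = z.
Proof. by move=> z0; rewrite cpowE// mul1r cexp_clog. Qed.

Lemma cpowD z p q : z != 0 -> cpow z (p + q) = cpow z p * cpow z q.
Proof. by move=> z0; rewrite !cpowE// rmorphD mulrDl cexpD. Qed.

Lemma Re_cpow z p : z != 0 ->
  Rez (cpow z p) = normc z `^ p * cos (p * carg z).
Proof.
move=> z0; rewrite cpowE// Re_cexp ReM ImM /= !mul0r subr0 addr0.
by rewrite /powR normc_eq0 (negPf z0).
Qed.

Lemma Im_cpow z p : z != 0 ->
  Imz (cpow z p) = normc z `^ p * sin (p * carg z).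
Proof.
move=> z0; rewrite cpowE// Im_cexp ReM ImM /= !mul0r subr0 addr0.
by rewrite /powR normc_eq0 (negPf z0).
Qed.

Lemma normc_cpow z p : z != 0 -> normc (cpow z p) = normc z `^ p.
Proof.
move=> z0; rewrite cpowE// normc_cexp ReM /= mul0r subr0.
by rewrite /powR normc_eq0 (negPf z0).
Qed.

Lemma carg_scale r z : 0 < r -> carg (r%:C * z) = carg z.
Proof.
move=> r0; rewrite /carg normcM normcR gtr0_norm// ReM ImM /= !mul0r subr0 addr0.
by rewrite pmulr_rlt0// -mulf_div divff ?gt_eqF// mul1r.
Qed.

Lemma cpow_scale r z p : 0 < r -> z != 0 ->
  cpow (r%:C * z) p = (r `^ p)%:C * cpow z p.
Proof.
move=> r0 z0.
have rz0 : r%:C * z != 0.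
  by rewrite mulf_neq0// eq_complex /= gt_eqF.
apply: eq_ReIm.
  rewrite Re_cpow// ReM /= mul0r subr0 Re_cpow// carg_scale//.
  by rewrite normcM normcR gtr0_norm// powRM ?normc_ge0 ?ltW// mulrA.
rewrite Im_cpow// ImM /= mul0r addr0 Im_cpow// carg_scale//.
by rewrite normcM normcR gtr0_norm// powRM ?normc_ge0 ?ltW// mulrA.
Qed.

Lemma abs_carg_le z : 0 <= Rez z -> `|carg z| <= pi / 2.
Proof.
move=> h; have -> : `|carg z| = acos (Rez z / normc z).
  rewrite /carg; case: ifP => _; rewrite ?mulN1r ?mul1r ?normrN ger0_norm//;
  by rewrite acos_ge0// Re_div_normc_itv.
rewrite leNgt; apply/negP => lt.
have /andP[h1 h2] := Re_div_normc_itv z.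
have hp : (pi / 2 : R) \in (`[0, pi]%R : interval R).
  by rewrite in_itv/=; have := pi_ge0 R; lra.
have ha : acos (Rez z / normc z) \in (`[0, pi]%R : interval R).
  by rewrite in_itv/= acos_ge0 ?acos_lepi ?h1.
have : cos (acos (Rez z / normc z)) < cos (pi / 2 : R) by rewrite ltr_cos.
rewrite cos_pihalf acosK ?in_itv/= ?h1//.
by rewrite ltNge divr_ge0// normc_ge0.
Qed.

End ComplexFunctions.

(** * The symbol of the Zener operator *)

Section SineBound.
Variable R : realType.

(** The difference of the two sides has derivative a (cos (a y) - cos y), nonnegative because cosine
    decreases on [0, pi] and a y <= y. *)
Lemma sin_scale_ge (a x : R) : 0 <= a <= 1 -> 0 <= x <= pi / 2 ->
  a * sin x <= sin (a * x).
Proof.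
move=> /andP[a0 a1] /andP[x0 xpi].
pose f := fun y : R => sin (a * y) - a * sin y.
have df (y : R) : is_derive y 1 f (a * cos (a * y) - a * cos y).
  rewrite /f; apply: is_derive_eq.
  rewrite -[in X in X = _]/(a *: cos y) /GRing.scale /=; ring.
suff : f 0 <= f x.
  by rewrite /f !mulr0 !sin0 mulr0 subr0 subr_ge0.
have [->//|xn0] := eqVneq x 0.
have x0' : 0 < x by rewrite lt_neqAle eq_sym xn0.
have [y /andP[y0 yx] hy] : exists2 y, 0 <= y <= x &
    f x - f 0 = (a * cos (a * y) - a * cos y) * (x - 0).
  have cf : {within `[0, x], continuous f}.
    by apply: derivable_within_continuous => y _; exact: ex_derive.
  have [y yI ->] := MVT x0' (fun y _ => df y) cf.
  by exists y => //; move: yI; rewrite in_itv/= => /andP[/ltW-> /ltW->].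
rewrite -subr_ge0 hy subr0 mulr_ge0// -mulrBr mulr_ge0// subr_ge0.
have pi0 := pi_ge0 R.
have ay : a * y <= y by rewrite ler_piMl.
have ay0 : 0 <= a * y by rewrite mulr_ge0.
by rewrite leNgt ltr_cos -?leNgt// in_itv/=; lra.
Qed.

(** Both sides are even in [x], so the previous bound on nonnegative angles suffices, multiplied by
    sin x >= 0. *)
Lemma sin_mul_sin_scale_ge (a x : R) : 0 <= a <= 1 -> `|x| <= pi / 2 ->
  a * sin x ^+ 2 <= sin x * sin (a * x).
Proof.
move=> a01 xpi.
wlog x0 : x xpi / 0 <= x.
  move=> H; have [|/ltW x0] := leP 0 x; first exact: H.
  have := H (- x); rewrite normrN oppr_ge0 => /(_ xpi x0).
  by rewrite mulrN !sinN sqrrN mulrNN.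
rewrite ger0_norm// in xpi.
rewrite expr2 mulrCA ler_wpM2l//; last by rewrite sin_scale_ge// x0.
by apply: sin_ge0_pi; have := pi_ge0 R; lra.
Qed.

End SineBound.

(** * The power s^alpha and the principal root of the Zener quotient *)

Section ZenerSymbol.
Variables (R : realType) (alpha tau : R).
Hypotheses (halpha : 0 < alpha < 1) (htau : 0 < tau < 1).
Implicit Types s z : R[i].

Lemma Re_cpow_ge0 s : 0 <= Rez s -> s != 0 -> 0 <= Rez (cpow s alpha).
Proof.
case/andP: halpha => a0 a1 hs s0; rewrite Re_cpow// mulr_ge0 ?powR_ge0//.
have := abs_carg_le hs; rewrite ler_norml => /andP[h1 h2].
by apply: cos_ge0_pihalf; apply/andP; split; nra.
Qed.

(** The source of all damping. In polar form the claim is the sine inequality above for the argument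
    of [s]: a power below 1 shrinks the argument, but by no more than the factor [alpha] at the
    level of sines. *)
Lemma Im_mul_Im_cpow_ge s : 0 <= Rez s -> s != 0 ->
  alpha * (Imz s ^+ 2 * normc s `^ (alpha - 1)) <= Imz s * Imz (cpow s alpha).
Proof.
case/andP: halpha => a0 a1 hs s0.
have n0 : 0 < normc s by rewrite normc_gt0.
have Is : Imz s = normc s * sin (carg s).
  by rewrite sin_carg// mulrCA divff ?mulr1// gt_eqF.
rewrite Im_cpow// {1 2}Is.
rewrite powRD ?(gt_eqF n0) ?implybT// powR_inv1 ?normc_ge0//.
have -> : alpha * ((normc s * sin (carg s)) ^+ 2 * (normc s `^ alpha / normc s)) =
  (normc s * normc s `^ alpha) * (alpha * sin (carg s) ^+ 2).
  by field; rewrite gt_eqF.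
have -> : normc s * sin (carg s) * (normc s `^ alpha * sin (alpha * carg s)) =
  (normc s * normc s `^ alpha) * (sin (carg s) * sin (alpha * carg s)) by ring.
apply: ler_wpM2l; first by rewrite mulr_ge0 ?powR_ge0 ?normc_ge0.
by apply: sin_mul_sin_scale_ge; [rewrite !ltW | exact: abs_carg_le].
Qed.

Section Quotient.
Variable z : R[i].
Hypothesis hz : 0 <= Rez z.

(** Here [z] stands for s^alpha, so that [u] is l(s)^2 and [l] is l(s). *)
Let u := (1 + tau%:C * z) / (1 + z).
Let l := sqrtc u.

Lemma normc_1D_ge1 : 1 <= normc (1 + z).
Proof. by apply: le_trans (le_trans (ler_norm _) (abs_Re_le _)); rewrite ReD Re1 lerDl. Qed.

Lemma oneD_neq0 : 1 + z != 0.
Proof. by rewrite -normc_gt0 (lt_le_trans ltr01 normc_1D_ge1). Qed.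

Lemma Re_zener_quotient_gt0 : 0 < Rez u.
Proof.
case/andP: htau => t0 t1.
have d0 : 0 < normc (1 + z) ^+ 2.
  by rewrite exprn_gt0// (lt_le_trans ltr01 normc_1D_ge1).
rewrite /u ReM ReV ImV !ReD !ImD ReM ImM Re1 Im1 /=.
rewrite !mul0r subr0 addr0 !add0r.
have -> : (1 + tau * Rez z) * ((1 + Rez z) / normc (1 + z) ^+ 2) -
   tau * Imz z * - (Imz z / normc (1 + z) ^+ 2) =
   ((1 + tau * Rez z) * (1 + Rez z) + tau * Imz z ^+ 2) / normc (1 + z) ^+ 2 by ring.
rewrite divr_gt0//; have := sqr_ge0 (Imz z).
by move: hz t0 t1; move: (Rez z) (Imz z ^+ 2) => x y *; nra.
Qed.

Lemma Im_zener_quotient : Imz u = - ((1 - tau) * Imz z / normc (1 + z) ^+ 2).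
Proof. by rewrite /u ImM ReV ImV !ReD !ImD ReM ImM Re1 Im1 /=; ring. Qed.

Lemma oneB_zener_quotient : 1 - u = (1 - tau)%:C * z / (1 + z).
Proof.
rewrite /u rmorphB /=; field; exact: oneD_neq0.
Qed.

Lemma normc_zener_quotient_le1 : normc u <= 1.
Proof.
case/andP: htau => t0 t1.
rewrite /u normcM ComplexField.Normc.normcV.
rewrite ler_pdivrMr ?(lt_le_trans ltr01 normc_1D_ge1)// mul1r.
rewrite -(ler_pXn2r (_ : (0 < 2)%N))// ?nnegrE ?normc_ge0//.
rewrite !normc_sqr !ReD !ImD ReM ImM Re1 Im1 /= !mul0r subr0 addr0 !add0r.
rewrite exprMn lerD//.
  have h0 : 0 <= tau * Rez z by rewrite mulr_ge0// ltW.
  have h1 : tau * Rez z <= Rez z by rewrite ler_piMl// ltW.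
  by rewrite ler_sqr ?nnegrE; lra.
by rewrite ler_piMl ?sqr_ge0// expr_le1// ltW.
Qed.

Lemma sqr_zener_root : l ^+ 2 = u.
Proof. exact: sqr_sqrtc. Qed.

Lemma Re_sqrtc_ge0 (x : R[i]) : 0 <= Rez (sqrtc x).
Proof. by case: x => a b; exact: sqrtr_ge0. Qed.

(** If Re l vanished, l^2 would be real and nonpositive, against Re u > 0. *)
Lemma Re_zener_root_gt0 : 0 < Rez l.
Proof.
rewrite lt_neqAle Re_sqrtc_ge0 andbT eq_sym; apply/eqP => l0.
have := Re_zener_quotient_gt0; rewrite -sqr_zener_root expr2 ReM l0.
by rewrite mul0r sub0r oppr_gt0 ltNge -expr2 sqr_ge0.
Qed.

Lemma normc_zener_root_le1 : normc l <= 1.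
Proof.
rewrite -(expr_le1 (_ : (0 < 2)%N))// ?normc_ge0//.
by rewrite -normcX sqr_zener_root normc_zener_quotient_le1.
Qed.

(** From Im u = 2 Re l Im l and 0 < Re l <= 1, the imaginary part of [l] has the sign of Im u and at
    least half its size. The weight [v], later Im s, replaces a case distinction on that sign. *)
Lemma Im_zener_root_le (v : R) : 0 <= v * Imz z ->
  v * Imz l <= - ((1 - tau) * (v * Imz z) / (2 * normc (1 + z) ^+ 2)).
Proof.
case/andP: htau => t0 t1 hv.
have d0 : 0 < normc (1 + z) ^+ 2.
  by rewrite exprn_gt0// (lt_le_trans ltr01 normc_1D_ge1).
have Rl := Re_zener_root_gt0.
have Rl1 : Rez l <= 1.
  exact: le_trans (le_trans (ler_norm _) (abs_Re_le _)) normc_zener_root_le1.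
have h : 2 * (Rez l * (v * Imz l)) = v * Imz u.
  by rewrite -sqr_zener_root expr2 ImM; ring.
have -> : - ((1 - tau) * (v * Imz z) / (2 * normc (1 + z) ^+ 2)) = v * Imz u / 2.
  by rewrite Im_zener_quotient; field; rewrite normc_eq0 (oneD_neq0).
have vu : v * Imz u <= 0.
  rewrite Im_zener_quotient.
  have -> : v * - ((1 - tau) * Imz z / normc (1 + z) ^+ 2) =
    - ((1 - tau) * (v * Imz z) / normc (1 + z) ^+ 2) by ring.
  by rewrite oppr_le0 divr_ge0 ?(ltW d0)// mulr_ge0// subr_ge0 ltW.
move: h vu; move: (v * Imz u) (v * Imz l) => y x h vu.
have x0 : x <= 0.
  by rewrite leNgt; apply/negP => x0; have := mulr_gt0 Rl x0; lra.
by nra.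
Qed.

End Quotient.

End ZenerSymbol.

(* The abscissa t^-2 is negligible against the frequency scale, so the rescaled
   contour tends to the imaginary axis; as t * t^-2 <= 1, the factor exp(s t)
   stays bounded along it. *)
Definition contour (R : realType) (alpha t w : R) : R[i] :=
  (t ^- 2) +i* (t `^ (- (1 / (1 + alpha))) * w).

(** * Decay of the integrand along the contour *)

Section Decay.
Variables (R : realType) (alpha tau : R).
Hypotheses (halpha : 0 < alpha < 1) (htau : 0 < tau < 1).
Implicit Types (s z : R[i]) (t w x : R).

Local Notation l := (zener_l alpha tau).

Lemma one_powR (p : R) : 1 `^ p = 1.
Proof. by rewrite powR1. Qed.

Lemma Re_mul_zener_l_ge s : 0 <= Rez s -> s != 0 ->
  (1 - tau) * alpha / 2 *
    (Imz s ^+ 2 * normc s `^ (alpha - 1) / (1 + normc s `^ alpha) ^+ 2)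
  <= Rez (s * l s).
Proof.
move=> hs s0; have /andP[t0 t1] := htau; have /andP[a0 a1] := halpha.
have hz := Re_cpow_ge0 halpha hs s0.
have hI := Im_mul_Im_cpow_ge halpha hs s0.
have q0 : 0 <= Imz s ^+ 2 * normc s `^ (alpha - 1).
  by rewrite mulr_ge0 ?sqr_ge0 ?powR_ge0.
have I0 : 0 <= Imz s * Imz (cpow s alpha).
  by apply: le_trans hI; rewrite mulr_ge0// ltW.
have /= hl := Im_zener_root_le htau hz I0.
have Rl := Re_zener_root_gt0 htau hz.
rewrite ReM lerBrDr.
(* The term Re s Re l(s) is nonnegative and is dropped; all the decay comes from - Im s Im l(s). *)
apply: le_trans (_ : 0 <= _); last by rewrite mulr_ge0// ltW.
rewrite -lerBrDr sub0r lerNr.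
apply: le_trans hl _; rewrite lerN2.
have n1 := normc_1D_ge1 hz.
have n2 : normc (1 + cpow s alpha) <= 1 + normc s `^ alpha.
  by rewrite -normc_cpow// (le_trans (le_normcD _ _))// ComplexField.Normc.normc1.
have -> : (1 - tau) * alpha / 2 *
    (Imz s ^+ 2 * normc s `^ (alpha - 1) / (1 + normc s `^ alpha) ^+ 2) =
  (1 - tau) / 2 * (alpha * (Imz s ^+ 2 * normc s `^ (alpha - 1))) *
    (1 + normc s `^ alpha) ^- 2 by ring.
have -> : (1 - tau) * (Imz s * Imz (cpow s alpha)) /
    (2 * normc (1 + cpow s alpha) ^+ 2) =
  (1 - tau) / 2 * (Imz s * Imz (cpow s alpha)) * normc (1 + cpow s alpha) ^- 2.
  by field; rewrite normc_eq0 oneD_neq0.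
have t2 : 0 <= (1 - tau) / 2 by lra.
apply: ler_pM.
- by rewrite mulr_ge0// mulr_ge0// ltW.
- by rewrite invr_ge0 exprn_ge0// addr_ge0 ?powR_ge0.
- exact: ler_wpM2l.
- by rewrite lef_pV2 ?posrE ?exprn_gt0 ?ltr_pwDl ?powR_ge0 ?(lt_le_trans ltr01)//
    lerXn2r ?nnegrE ?normc_ge0 ?addr_ge0 ?powR_ge0.
Qed.

Lemma contour_scale_gt0 t : 1 <= t -> 0 < t `^ (- (1 / (1 + alpha))).
Proof. by move=> t1; rewrite powR_gt0 ?(lt_le_trans ltr01). Qed.

Lemma Re_contour_gt0 t w : 1 <= t -> 0 < Rez (contour alpha t w).
Proof. by move=> t1; rewrite /= invr_gt0 exprn_gt0 ?(lt_le_trans ltr01). Qed.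

Lemma contour_neq0 t w : 1 <= t -> contour alpha t w != 0.
Proof. by move=> /(Re_contour_gt0 w) /= h; rewrite eq_complex /= (gt_eqF h). Qed.

Lemma invr_sqr_le_contour_scale t : 1 <= t -> t ^- 2 <= t `^ (- (1 / (1 + alpha))).
Proof.
have /andP[a0 a1] := halpha.
move=> t1; rewrite -powR_invn ?(le_trans ler01)// ler_powR// lerN2.
by rewrite ler_pdivrMr; lra.
Qed.

(** For |w| >= 1 the imaginary part of [s] controls |s| within a factor 2. The 64 is 2 * 2 * 4 * 4:
    one 2 from t / 2, one from the bound on Re (s l(s)), one 4 from |s|^2 <= 4 (Im s)^2, and one
    from the denominator (1 + |s|^alpha)^2. *)
Lemma decay_zener_l t w : 1 <= t -> 1 <= `|w| ->
  (1 - tau) * alpha / 64 * `|w| `^ (1 - alpha) <=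
  t / 2 * Rez (contour alpha t w * l (contour alpha t w)).
Proof.
move=> t1 w1; have /andP[t0' t1'] := htau; have /andP[a0 a1] := halpha.
have t0 : 0 < t by rewrite (lt_le_trans ltr01).
have w0 : 0 < `|w| by rewrite (lt_le_trans ltr01).
set s := contour alpha t w; set L := t `^ (- (1 / (1 + alpha))).
have L0 : 0 < L by exact: contour_scale_gt0.
have hIm : `|Imz s| = L * `|w| by rewrite /= normrM gtr0_norm.
have Lw0 : 0 < L * `|w| by rewrite mulr_gt0.
have r1 : L * `|w| <= normc s by rewrite -hIm abs_Im_le.
have r0 : 0 < normc s by exact: lt_le_trans r1.
have r2 : normc s <= 2 * (L * `|w|).
  apply: le_trans (normc_le_ReIm _) _; rewrite hIm mulr_natl mulr2n lerD2r.
  rewrite /= ger0_norm ?invr_ge0 ?exprn_ge0 ?(ltW t0)//.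
  by rewrite (le_trans (invr_sqr_le_contour_scale t1))// ler_peMr// ltW.
have Hs : normc s ^+ 2 / 4 <= Imz s ^+ 2.
  rewrite -(real_normK (num_real (Imz s))) hIm ler_pdivrMr//.
  have -> : (L * `|w|) ^+ 2 * 4 = (2 * (L * `|w|)) ^+ 2 by ring.
  by rewrite lerXn2r ?nnegrE ?normc_ge0// mulr_ge0// ltW.
have d0 : 0 < 1 + normc s `^ alpha by rewrite ltr_pwDl// powR_ge0.
have Lp (p : R) : L `^ p = t `^ (- (p / (1 + alpha))).
  by rewrite /L -powRrM; congr powR; ring.
(* Two regimes. If |s| <= 1 the denominator is at most 4 and |s|^(1+alpha) >= |w|^(1+alpha) / t. If
   |s| > 1 it is at most 4 |s|^(2 alpha), leaving |s|^(1-alpha) >= t^(-(1-alpha)/(1+alpha))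
   |w|^(1-alpha), where the exponent of t is at least -1. *)
have claim : `|w| `^ (1 - alpha) / (4 * t) <=
    normc s `^ (1 + alpha) / (1 + normc s `^ alpha) ^+ 2.
  rewrite ler_pdivlMr ?exprn_gt0//.
  have [rle|rge] := leP (normc s) 1.
    have ra : normc s `^ alpha <= 1.
      rewrite -[leRHS](one_powR alpha); apply: ge0_ler_powR => //; rewrite ?nnegrE ?normc_ge0//.
      exact: ltW.
    apply: le_trans (_ : `|w| `^ (1 - alpha) / (4 * t) * 4 <= _).
      apply: ler_wpM2l; first by rewrite divr_ge0 ?powR_ge0// mulr_ge0// ltW.
      have -> : (4 : R) = 2 ^+ 2 by ring.
      rewrite lerXn2r ?nnegrE ?(ltW d0)//; lra.
    have -> : `|w| `^ (1 - alpha) / (4 * t) * 4 = t^-1 * `|w| `^ (1 - alpha).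
      by field; rewrite gt_eqF.
    apply: le_trans (_ : (L * `|w|) `^ (1 + alpha) <= _); last first.
      by apply: ge0_ler_powR; rewrite ?nnegrE ?normc_ge0//; [lra|exact: ltW].
    rewrite powRM ?(ltW L0)// Lp divff; last by rewrite gt_eqF//; lra.
    rewrite powR_inv1 ?(ltW t0)// ler_wpM2l ?invr_ge0 ?(ltW t0)//.
    rewrite ler_powR//; lra.
  have ra : 1 <= normc s `^ alpha.
    by rewrite -(powRr0 (normc s)) ler_powR// ltW.
  apply: le_trans (_ : `|w| `^ (1 - alpha) / (4 * t) * (2 * normc s `^ alpha) ^+ 2 <= _).
    apply: ler_wpM2l; first by rewrite divr_ge0 ?powR_ge0// mulr_ge0// ltW.
    rewrite lerXn2r ?nnegrE ?(ltW d0)//; lra.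
  have -> : `|w| `^ (1 - alpha) / (4 * t) * (2 * normc s `^ alpha) ^+ 2 =
     t^-1 * `|w| `^ (1 - alpha) * normc s `^ alpha ^+ 2.
    by field; rewrite gt_eqF.
  have -> : normc s `^ (1 + alpha) = normc s `^ (1 - alpha) * normc s `^ alpha ^+ 2.
    rewrite expr2 -!powRD ?(gt_eqF r0) ?implybT//; congr powR; ring.
  apply: ler_wpM2r; first by rewrite exprn_ge0// powR_ge0.
  apply: le_trans (_ : (L * `|w|) `^ (1 - alpha) <= _); last first.
    by apply: ge0_ler_powR; rewrite ?nnegrE ?normc_ge0//; [lra|exact: ltW].
  rewrite powRM ?(ltW L0)// Lp; apply: ler_wpM2r; first exact: powR_ge0.
  rewrite -powR_inv1 ?(ltW t0)// ler_powR// lerN2 ler_pdivrMr; lra.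
have sr : 0 <= Rez s by rewrite ltW// Re_contour_gt0.
have := Re_mul_zener_l_ge sr (contour_neq0 w t1).
rewrite -/s; move: (Rez (s * l s)) => X HX.
have HY : `|w| `^ (1 - alpha) / (4 * t) / 4 <= 
    Imz s ^+ 2 * normc s `^ (alpha - 1) / (1 + normc s `^ alpha) ^+ 2.
  apply: le_trans (_ : normc s ^+ 2 / 4 * normc s `^ (alpha - 1) / (1 + normc s `^ alpha) ^+ 2 <= _).
    rewrite [leRHS](_ : _ = normc s `^ (1 + alpha) / (1 + normc s `^ alpha) ^+ 2 / 4).
      by rewrite ler_pM2r// invr_gt0.
    have -> : normc s `^ (1 + alpha) = normc s ^+ 2 * normc s `^ (alpha - 1).
      rewrite -powR_mulrn ?normc_ge0// -powRD ?(gt_eqF r0) ?implybT//; congr powR; ring.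
    by field; rewrite gt_eqF.
  apply: ler_wpM2r; first by rewrite invr_ge0 exprn_ge0// ltW.
  by apply: ler_wpM2r; first exact: powR_ge0.
have -> : (1 - tau) * alpha / 64 * `|w| `^ (1 - alpha) =
   t / 2 * ((1 - tau) * alpha / 2 * (`|w| `^ (1 - alpha) / (4 * t) / 4)).
  by field; rewrite gt_eqF.
apply: ler_wpM2l; first by rewrite divr_ge0// ltW.
apply: le_trans HX; apply: ler_wpM2l => //.
by rewrite divr_ge0// mulr_ge0 ?subr_ge0// ltW.
Qed.

(** The summand 1 in the exponent makes this at least 1 for |w| <= 1, where no decay is available,
    so a single formula dominates on the whole line. *)
Definition decay w := expR ((1 - tau) * alpha / 64 * (1 - `|w| `^ (1 - alpha))).

Lemma expR_zener_l_le_decay t w x : 1 <= t -> t / 2 <= x ->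
  expR (- (x * Rez (contour alpha t w * l (contour alpha t w)))) <= decay w.
Proof.
move=> t1 xt; have /andP[t0' t1'] := htau; have /andP[a0 a1] := halpha.
have t0 : 0 < t by rewrite (lt_le_trans ltr01).
have c0 : 0 <= (1 - tau) * alpha / 64 by rewrite divr_ge0// mulr_ge0 ?subr_ge0// ltW.
set s := contour alpha t w.
have X0 : 0 <= Rez (s * l s).
  have sr : 0 <= Rez s by rewrite ltW// Re_contour_gt0.
  apply: le_trans (Re_mul_zener_l_ge sr (contour_neq0 w t1)).
  rewrite mulr_ge0//; first by rewrite divr_ge0// mulr_ge0 ?subr_ge0// ltW.
  by rewrite divr_ge0 ?sqr_ge0// mulr_ge0 ?sqr_ge0 ?powR_ge0.
rewrite ler_expR.
have [w1|w1] := leP 1 `|w|.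
  have := decay_zener_l t1 w1; rewrite -/s => h.
  have : t / 2 * Rez (s * l s) <= x * Rez (s * l s) by exact: ler_wpM2r.
  by move: h; rewrite mulrBr mulr1; lra.
apply: le_trans (_ : 0 <= _).
  by rewrite oppr_le0 mulr_ge0// (le_trans _ xt)// divr_ge0// ltW.
rewrite mulr_ge0// subr_ge0 -[leRHS](one_powR (1 - alpha)).
by apply: ge0_ler_powR; rewrite ?nnegrE ?(ltW w1)//; lra.
Qed.

Lemma decay_polynomial (n : nat) : exists2 C : R, 0 <= C &
  forall w, (1 + `|w|) ^+ n * decay w <= C * (1 + w ^+ 2)^-1.
Proof.
have /andP[t0' t1'] := htau; have /andP[a0 a1] := halpha.
rewrite /decay; set c := (1 - tau) * alpha / 64.
have c0 : 0 < c by rewrite divr_gt0// mulr_gt0// subr_gt0.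
have g0 : 0 < 1 - alpha by rewrite subr_gt0.
(* The exponential is bounded below by the term of order k + 1 of its series. That term grows like
   |w|^((1-alpha)(k+1)), which has to absorb degree n from the factor and degree 2 from 1 + w^2. *)
have [k hk] : exists k : nat, (n.+2)%:R <= (1 - alpha) * k.+1%:R.
  exists (Num.truncn (n.+2%:R / (1 - alpha))).
  by rewrite mulrC -ler_pdivrMr// ltW// truncnS_gt.
(* The two summands of the last factor serve |w| <= 1 and |w| >= 1 respectively; 2^(n+1) comes from
   1 + y <= 2 max(1, y) and 1 + y^2 <= 2 max(1, y^2). *)
pose C := 2 ^+ n.+1 * expR c * (1 + (k.+1)`!%:R / c ^+ k.+1).
have q0 : 0 <= (k.+1)`!%:R / c ^+ k.+1 by rewrite divr_ge0 ?ler0n// exprn_ge0// ltW.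
exists C; first by rewrite !mulr_ge0 ?exprn_ge0 ?expR_ge0// addr_ge0.
move=> w.
have d0 : 0 < 1 + w ^+ 2 by rewrite ltr_pwDl// sqr_ge0.
rewrite ler_pdivlMr// mulrBr mulr1 expRD.
rewrite -(real_normK (num_real w)).
have y0 : 0 <= `|w| by [].
move: `|w| y0 => y y0.
have [y1|/ltW y1] := leP y 1.
  have h1 : (1 + y) ^+ n <= 2 ^+ n by rewrite lerXn2r ?nnegrE; lra.
  have h2 : 1 + y ^+ 2 <= 2 by have : y ^+ 2 <= 1 by [rewrite expr_le1//]; lra.
  have h3 : expR (- (c * y `^ (1 - alpha))) <= 1.
    by rewrite expR_le1 oppr_le0 mulr_ge0 ?powR_ge0// ltW.
  apply: le_trans (_ : 2 ^+ n.+1 * expR c <= _); last first.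
    by rewrite /C mulrDr mulr1 lerDl mulr_ge0// mulr_ge0 ?exprn_ge0 ?expR_ge0.
  have -> : 2 ^+ n.+1 * expR c = 2 ^+ n * (expR c * 1) * 2 by rewrite exprS; ring.
  apply: ler_pM; rewrite ?mulr_ge0 ?exprn_ge0 ?expR_ge0 ?addr_ge0 ?sqr_ge0//.
  apply: ler_pM; rewrite ?mulr_ge0 ?exprn_ge0 ?expR_ge0 ?addr_ge0 ?sqr_ge0//.
  by rewrite ler_wpM2l ?expR_ge0.
have y0' : 0 < y by rewrite (lt_le_trans ltr01).
have h1 : (1 + y) ^+ n <= (2 * y) ^+ n by rewrite lerXn2r ?nnegrE; lra.
have h2 : 1 + y ^+ 2 <= 2 * y ^+ 2.
  by have : 1 <= y ^+ 2 by [rewrite expr_ge1//]; lra.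
have h3 : expR (- (c * y `^ (1 - alpha))) <= (k.+1)`!%:R / c ^+ k.+1 / y ^+ n.+2.
  have P0 : 0 < c * y `^ (1 - alpha) by rewrite mulr_gt0// powR_gt0.
  have F0 : 0 < (k.+1)`!%:R :> R by rewrite ltr0n fact_gt0.
  have := expR_ge1Dxn k (ltW P0).
  have Q0 : 0 < (c * y `^ (1 - alpha)) ^+ k.+1 / (k.+1)`!%:R.
    by rewrite divr_gt0// exprn_gt0.
  move=> h; rewrite expRN.
  apply: le_trans (_ : ((c * y `^ (1 - alpha)) ^+ k.+1 / (k.+1)`!%:R)^-1 <= _).
    by rewrite lef_pV2 ?posrE ?expR_gt0//; lra.
  rewrite invf_div exprMn invfM mulrA ler_wpM2l//.
  rewrite lef_pV2 ?posrE ?exprn_gt0 ?powR_gt0//.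
  rewrite -!powR_mulrn ?powR_ge0// -powRrM ler_powR//.
apply: le_trans (_ : (2 * y) ^+ n * (expR c * ((k.+1)`!%:R / c ^+ k.+1 / y ^+ n.+2)) * (2 * y ^+ 2) <= _).
  apply: ler_pM; rewrite ?mulr_ge0 ?exprn_ge0 ?expR_ge0 ?addr_ge0 ?sqr_ge0//.
  apply: ler_pM; rewrite ?mulr_ge0 ?exprn_ge0 ?expR_ge0 ?addr_ge0 ?sqr_ge0//.
  by rewrite ler_wpM2l ?expR_ge0.
rewrite exprMn.
have -> : 2 ^+ n * y ^+ n * (expR c * ((k.+1)`!%:R / c ^+ k.+1 / y ^+ n.+2)) * (2 * y ^+ 2) =
  2 ^+ n.+1 * expR c * ((k.+1)`!%:R / c ^+ k.+1).
  have -> : y ^+ n.+2 = y ^+ n * y ^+ 2 by rewrite -exprD addn2.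
  rewrite [2 ^+ n.+1]exprS; field.
  by rewrite !expf_neq0 ?gt_eqF.
rewrite ler_wpM2l ?mulr_ge0 ?exprn_ge0 ?expR_ge0//; lra.
Qed.

End Decay.

(** * Integrals over the real line *)

Section RealLineIntegrals.
Variable R : realType.
Local Notation mu := (@lebesgue_measure R).
Implicit Types (f g : R -> R).

Lemma integrable_dominated f g : measurable_fun [set: R] f ->
  (forall x, `|f x| <= g x) -> mu.-integrable [set: R] (EFin \o g) ->
  mu.-integrable [set: R] (EFin \o f).
Proof.
move=> mf fg; apply: le_integrable => //; first exact/measurable_EFinP.
move=> x _ /=; rewrite lee_fin (le_trans (fg x))// ler_norm//.
Qed.

Lemma EFin_Rintegral f : mu.-integrable [set: R] (EFin \o f) ->
  (\int[mu]_x f x)%:E = (\int[mu]_x (f x)%:E)%E.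
Proof. by move=> fi; rewrite /Rintegral fineK// integrable_fin_num. Qed.

Lemma ge0_integrableT_of_integral f (c : R) : measurable_fun [set: R] f ->
  (forall x, 0 <= f x) -> (\int[mu]_x (f x)%:E = c%:E)%E ->
  mu.-integrable [set: R] (EFin \o f).
Proof.
move=> mf f0 fc; apply/integrableP; split; first exact/measurable_EFinP.
under eq_integral => x _ do rewrite /= ger0_norm//.
by rewrite fc ltry.
Qed.

(** Lebesgue measure is its own image under negation. This serves to show that the integral of an
    odd function vanishes. *)
Lemma RintegralN f : mu.-integrable [set: R] (EFin \o f) ->
  (\int[mu]_x f (- x) = \int[mu]_x f x)%R.
Proof.
move=> fi.
pose N : measurableTypeR R -> measurableTypeR R := -%R.
have mN : measurable_fun [set: R] N by exact: oppr_measurable.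
have mf : measurable_fun [set: R] (EFin \o f) by exact: measurable_int fi.
have h2 : (\int[mu]_x `|(EFin \o f \o N) x| = \int[mu]_x `|(EFin \o f) x|)%E.
  rewrite -[in LHS](preimage_setT N).
  have := @ge0_integral_pushforward _ _ _ _ R N mN mu setT (abse \o (EFin \o f)).
  rewrite /= => <- //.
    by apply: eq_measure_integral => A mA _; exact: lebesgue_measureN.
  exact: measurableT_comp.
have fNi : mu.-integrable [set: R] ((EFin \o f) \o N).
  apply/integrableP; split; first exact: measurableT_comp.
  by rewrite h2; move/integrableP : fi => [].
rewrite /Rintegral; congr fine.
have := @integral_pushforward _ _ _ _ R N mN mu setT (EFin \o f) mf fNi measurableT.
rewrite /= => <-.
by apply: eq_measure_integral => A mA _; exact: lebesgue_measureN.
Qed.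

Lemma continuous_abel_kernel (e u : R) :
  continuous (fun w : R => expR (- (e * `|w|)) * (1 + cos (w * u))).
Proof.
move=> w; apply: cvgM.
  apply: continuous_comp; last exact: continuous_expR.
  by apply: cvgN; apply: cvgM; [exact: cvg_cst|exact: norm_continuous].
apply: cvgD; first exact: cvg_cst.
apply: continuous_comp; last exact: continuous_cos.
by apply: cvgM; [exact: cvg_id|exact: cvg_cst].
Qed.

(** Adding 1 to the cosine makes the integrand nonnegative, so that the fundamental theorem of
    calculus on a half-line yields value and integrability together. The cosine integral alone
    follows later by subtraction. *)
Lemma integral_abel_kernel_1Dcos (e u : R) : 0 < e ->
  (\int[mu]_w (expR (- (e * `|w|)) * (1 + cos (w * u)))%:E =
   (2 * (e^-1 + e / (e ^+ 2 + u ^+ 2)))%:E)%E.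
Proof.
move=> e0.
have d0 : 0 < e ^+ 2 + u ^+ 2 by rewrite ltr_pwDl ?exprn_gt0 ?sqr_ge0.
have c1 (y : R) : 0 <= 1 + cos y by have := cos_geN1 y; lra.
rewrite ge0_symfun_integralT; last 3 first.
- by move=> w; rewrite mulr_ge0 ?expR_ge0.
- exact: continuous_abel_kernel.
- by move=> w /=; rewrite normrN mulNr cosN.
rewrite -set_itvcy EFinM; congr (_ * _)%E.
(* The antiderivative that vanishes at infinity. *)
pose F w := expR (- (e * w)) *
  (- e^-1 + (u * sin (w * u) - e * cos (w * u)) / (e ^+ 2 + u ^+ 2)).
have dF (w : R) : is_derive w 1 F (expR (- (e * w)) * (1 + cos (w * u))).
  rewrite /F; apply: is_derive_eq.
  rewrite /GRing.scale /=; field.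
  by rewrite !gt_eqF.
under eq_integral => w.
  rewrite inE/= in_itv/= andbT => w0; rewrite ger0_norm//.
over.
rewrite /= (@ge0_continuous_FTC2y _ _ F 0 0).
- rewrite /F mulr0 oppr0 expR0 mul0r sin0 cos0 -EFinB; congr EFin; field.
  by rewrite !gt_eqF.
- by move=> w _; rewrite mulr_ge0 ?expR_ge0.
- apply: continuous_subspaceT => w; apply: cvgM.
    apply: continuous_comp; last exact: continuous_expR.
    by apply: cvgN; apply: cvgM; [exact: cvg_cst|exact: cvg_id].
  apply: cvgD; first exact: cvg_cst.
  apply: continuous_comp; last exact: continuous_cos.
  by apply: cvgM; [exact: cvg_id|exact: cvg_cst].
- pose K := e^-1 + (`|u| + e) / (e ^+ 2 + u ^+ 2).
  have bnd w : `|F w| <= expR (- (e * w)) * K.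
    rewrite /F normrM ger0_norm ?expR_ge0// ler_wpM2l ?expR_ge0//.
    rewrite (le_trans (ler_normD _ _))// lerD//.
      by rewrite normrN gtr0_norm// invr_gt0.
    rewrite normrM normfV (gtr0_norm d0) ler_pM2r ?invr_gt0//.
    have hs : `|sin (w * u)| <= 1 by rewrite ler_norml sin_geN1 sin_le1.
    have hc : `|cos (w * u)| <= 1 by rewrite ler_norml cos_geN1 cos_le1.
    apply: le_trans (ler_normB _ _) _; rewrite !normrM (gtr0_norm e0).
    by apply: lerD; apply: ler_piMr => //; exact: ltW.
  have lim0 : expR (- (e * w)) * K @[w --> +oo] --> (0 : R).
    rewrite -(mul0r K); apply: cvgM; last exact: cvg_cst.
    apply: (cvg_comp (fun w => e * w) (fun z => expR (- z))); last exact: cvgr_expR.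
    exact: gt0_cvgMry.
  apply: norm_cvg0.
  apply: (@squeeze_cvgr _ _ _ _ (cst 0) (fun w => expR (- (e * w)) * K)) => //.
    by near=> w; rewrite /= normr_ge0 bnd.
  exact: cvg_cst.
- by move=> w _; exact: ex_derive.
- apply: cvg_at_right_filter.
  by apply: differentiable_continuous; apply/derivable1_diffP; exact: ex_derive.
- by move=> w _; rewrite derive1E derive_val.
Unshelve. all: end_near. Qed.

Lemma integrable_expR_norm (e : R) : 0 < e ->
  mu.-integrable [set: R] (EFin \o (fun w => expR (- (e * `|w|)))).
Proof.
move=> e0.
have h := integral_abel_kernel_1Dcos 0 e0.
have i2 : mu.-integrable [set: R]
    (EFin \o (fun w : R => expR (- (e * `|w|)) * (1 + cos (w * 0)))).
  apply: ge0_integrableT_of_integral h.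
  exact: continuous_measurable_fun (@continuous_abel_kernel e 0).
  by move=> w; rewrite mulr0 cos0 mulr_ge0 ?expR_ge0.
apply: integrable_dominated i2.
  apply: continuous_measurable_fun => w.
  apply: continuous_comp; last exact: continuous_expR.
  by apply: cvgN; apply: cvgM; [exact: cvg_cst|exact: norm_continuous].
move=> w; rewrite mulr0 cos0 ger0_norm ?expR_ge0//.
by rewrite ler_peMr ?expR_ge0//; lra.
Qed.

Lemma Rintegral_abel_kernel (e u : R) : 0 < e ->
  (\int[mu]_w (expR (- (e * `|w|)) * cos (w * u)) = 2 * e / (e ^+ 2 + u ^+ 2))%R.
Proof.
move=> e0.
have d0 : 0 < e ^+ 2 + u ^+ 2 by rewrite ltr_pwDl ?exprn_gt0 ?sqr_ge0.
have ie := integrable_expR_norm e0.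
have ih v : mu.-integrable [set: R]
    (EFin \o (fun w : R => expR (- (e * `|w|)) * (1 + cos (w * v)))).
  apply: ge0_integrableT_of_integral (integral_abel_kernel_1Dcos v e0).
    exact: continuous_measurable_fun (@continuous_abel_kernel e v).
  by move=> w; rewrite mulr_ge0 ?expR_ge0//; have := cos_geN1 (w * v); lra.
have Ih v : (\int[mu]_w (expR (- (e * `|w|)) * (1 + cos (w * v))) =
    2 * (e^-1 + e / (e ^+ 2 + v ^+ 2)))%R.
  by rewrite /Rintegral integral_abel_kernel_1Dcos.
have I0 : (\int[mu]_w (expR (- (e * `|w|))) = 2 / e)%R.
  have := Ih 0.
  under eq_Rintegral => w _ do rewrite mulr0 cos0.
  rewrite RintegralZr// => h; apply: (@mulIf _ (1 + 1)).
    by rewrite gt_eqF//; lra.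
  by rewrite h; field; rewrite gt_eqF.
under eq_Rintegral => w _.
  rewrite (_ : _ * cos _ = expR (- (e * `|w|)) * (1 + cos (w * u)) - expR (- (e * `|w|))); last ring.
over.
rewrite /= RintegralB//; rewrite Ih I0; field.
by rewrite !gt_eqF.
Qed.

Lemma integrable_inv1Dsqr :
  mu.-integrable [set: R] (EFin \o (fun w => (1 + w ^+ 2)^-1)).
Proof.
have cf : continuous (fun w : R => (1 + w ^+ 2)^-1) := @continuous_oneDsqrV R.
have p0 (w : R) : 0 < 1 + w ^+ 2 by rewrite ltr_pwDl ?sqr_ge0.
have f0 (w : R) : 0 <= (1 + w ^+ 2)^-1 by rewrite invr_ge0 ltW.
apply: (@ge0_integrableT_of_integral _ (2 * (pi / 2))) => //.
  exact: continuous_measurable_fun.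
rewrite ge0_symfun_integralT//; last by move=> w /=; rewrite sqrrN.
rewrite -set_itvcy EFinM; congr (_ * _)%E.
rewrite (@ge0_continuous_FTC2y _ _ atan 0 (pi / 2))//.
- by rewrite atan0 sube0.
- exact: continuous_subspaceT.
- exact: cvgy_atan.
- by apply: cvg_at_right_filter; exact: continuous_atan.
- by move=> w _; rewrite derive1_atan.
Qed.

End RealLineIntegrals.

(** * Inversion of the cosine transform *)

Section CosineInversion.
Variable R : realType.
Local Notation mu := (@lebesgue_measure R).
Variables (g : R -> R) (lam t : R).
Hypothesis gi : mu.-integrable [set: R] (EFin \o g).
Hypothesis lam0 : 0 < lam.

(** The scale [lam] is carried along so that the frequency [lam * w] is the imaginary part of the
    rescaled contour. *)
Let Phi w := (\int[mu]_u (g u * cos (lam * w * (t - u))))%R.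

Let mg : measurable_fun [set: R] g.
Proof. by apply/measurable_EFinP; exact: measurable_int gi. Qed.

Let measurable_cos_shift w : measurable_fun [set: R] (fun u => cos (lam * w * (t - u))).
Proof.
apply: continuous_measurable_fun => u.
apply: continuous_comp; last exact: continuous_cos.
by apply: cvgM; [exact: cvg_cst|apply: cvgB; [exact: cvg_cst|exact: cvg_id]].
Qed.

Let integrable_Phi_body w :
  mu.-integrable [set: R] (EFin \o (fun u => g u * cos (lam * w * (t - u)))).
Proof.
apply: (integrable_dominated (g := fun u => `|g u|)).
- exact: measurable_funM.
- move=> u; rewrite normrM ler_piMr// ler_norml cos_geN1 cos_le1//.
- exact: integrable_norm.
Qed.

(** The factor exp(- e |w|) makes the double integral absolutely convergent, so Fubini applies and
    the inner integral over [w] becomes the Poisson kernel. *)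
Lemma Rintegral_abel_cosine (e : R) : 0 < e ->
  (\int[mu]_w (expR (- (e * `|w|)) * Phi w) =
   \int[mu]_u (g u * (2 * e / (e ^+ 2 + (lam * (t - u)) ^+ 2))))%R.
Proof.
move=> e0.
pose T := measurableTypeR R; pose f := fun p : T * T =>
  expR (- (e * `|p.1|)) * (g p.2 * cos (lam * p.1 * (t - p.2))).
have mf : measurable_fun [set: T * T] f.
  apply: measurable_funM.
    apply: measurableT_comp => //; apply: measurableT_comp => //.
    by apply: measurable_funM => //; exact: measurableT_comp.
  apply: measurable_funM; first exact: measurableT_comp.
  apply: measurableT_comp; first exact: continuous_measurable_fun (@continuous_cos R).
  apply: measurable_funM; first by apply: measurable_funM.
  by apply: measurable_funB.
have fi : ((mu : {measure set T -> \bar R}) \x (mu : {sigma_finite_measure set T -> \bar R}))%E.-integrable [set: T * T] (EFin \o f).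
  apply/integrable12ltyP; first exact/measurable_EFinP.
  apply: (@le_lt_trans _ _ (\int[mu]_w ((expR (- (e * `|w|)))%:E * \int[mu]_u `|(g u)%:E|))%E).
    apply: ge0_le_integral => //.
    - by move=> w _; exact: integral_ge0.
    - apply: (@measurable_fun_fubini_tonelli_F _ _ T T R mu (abse \o (EFin \o f))) => //=.
      by apply: measurableT_comp => //; exact/measurable_EFinP.
    - apply: emeasurable_funM => //; apply/measurable_EFinP.
      by apply/measurable_EFinP; exact: measurable_int (integrable_expR_norm e0).
    - move=> w _; rewrite -ge0_integralZl//;
        [|by apply: measurableT_comp => //; exact/measurable_EFinP].
      apply: ge0_le_integral => //.
      + apply: measurableT_comp => //; apply/measurable_EFinP.
        exact: (measurableT_comp mf (pair1_measurable w)).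
      + apply: emeasurable_funM => //.
        by apply: measurableT_comp => //; exact/measurable_EFinP.
      + move=> u _; rewrite lee_fin /f /= normrM ger0_norm ?expR_ge0//.
        rewrite ler_wpM2l ?expR_ge0// normrM ler_piMr// ler_norml cos_geN1 cos_le1//.
  have /integrableP[_ gfin] := gi.
  have gnum : (\int[mu]_u `|(g u)%:E|)%E \is a fin_num.
    by rewrite ge0_fin_numE//; exact: integral_ge0.
  rewrite -(fineK gnum) ge0_integralZr//.
  - have := integrable_fin_num measurableT (integrable_expR_norm e0).
    rewrite /= => h; rewrite -(fineK h) -EFinM; exact: ltry.
  - exact: measurable_int (integrable_expR_norm e0).
  - by rewrite lee_fin fine_ge0// integral_ge0.
have := Fubini fi; rewrite /f /= => F.
rewrite /Rintegral; congr fine.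
transitivity (\int[mu]_w \int[mu]_u
    (expR (- (e * `|w|)) * (g u * cos (lam * w * (t - u))))%:E)%E.
  apply: eq_integral => w _.
  rewrite EFinM (EFin_Rintegral (integrable_Phi_body w)).
  by rewrite -integralZl//; exact: integrable_Phi_body.
rewrite F; apply: eq_integral => u _.
have ia : mu.-integrable [set: R]
    (EFin \o (fun w : R => expR (- (e * `|w|)) * cos (w * (lam * (t - u))))).
  apply: integrable_dominated (integrable_expR_norm e0).
    apply: continuous_measurable_fun => w; apply: cvgM.
      apply: continuous_comp; last exact: continuous_expR.
      by apply: cvgN; apply: cvgM; [exact: cvg_cst|exact: norm_continuous].
    apply: continuous_comp; last exact: continuous_cos.
    by apply: cvgM; [exact: cvg_id|exact: cvg_cst].
  move=> w; rewrite normrM ger0_norm ?expR_ge0// ler_piMr ?expR_ge0//.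
  by rewrite ler_norml cos_geN1 cos_le1.
rewrite -(Rintegral_abel_kernel _ e0) EFinM EFin_Rintegral// -integralZl//; apply: eq_integral => w _; rewrite -EFinM; congr EFin.
by rewrite (_ : w * (lam * (t - u)) = lam * w * (t - u)); ring.
Qed.

Lemma continuous_poisson_kernel (e : R) : 0 < e ->
  continuous (fun u => 2 * e / (e ^+ 2 + (lam * (t - u)) ^+ 2)).
Proof.
move=> e0 u; apply: cvgM; first exact: cvg_cst.
apply: cvgV; first by rewrite gt_eqF// ltr_pwDl ?exprn_gt0 ?sqr_ge0.
apply: cvgD; first exact: cvg_cst.
apply: (cvg_comp (fun v => lam * (t - v)) (fun y => y ^+ 2)).
  apply: cvgM; first exact: cvg_cst.
  by apply: cvgB; [exact: cvg_cst|exact: cvg_id].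
exact: exprn_continuous.
Qed.

Lemma integral_poisson_near (e d : R) : 0 < e -> 0 < d ->
  (\int[mu]_(u in `[t - d, t + d]) (2 * e / (e ^+ 2 + (lam * (t - u)) ^+ 2)) =
   4 / lam * atan (lam * d / e))%R.
Proof.
move=> e0 d0.
have q0 (y : R) : 0 < e ^+ 2 + y ^+ 2 by rewrite ltr_pwDl ?exprn_gt0 ?sqr_ge0.
pose F u := 2 / lam * atan (lam / e * (u - t)).
have dF (u : R) : is_derive u 1 F (2 * e / (e ^+ 2 + (lam * (t - u)) ^+ 2)).
  rewrite /F; apply: is_derive_eq.
  rewrite /GRing.scale /=; field.
  by rewrite !gt_eqF//=.
rewrite /Rintegral (@continuous_FTC2 _ _ F).
- rewrite -EFinB /F /=.
  rewrite (_ : lam / e * (t - d - t) = - (lam * d / e)); last ring.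
  rewrite (_ : lam / e * (t + d - t) = lam * d / e); last ring.
  by rewrite atanN; field; rewrite gt_eqF.
- lra.
- exact/continuous_subspaceT/continuous_poisson_kernel.
- have cF (u : R) : F x @[x --> u] --> F u.
    by apply: differentiable_continuous; apply/derivable1_diffP; exact: ex_derive.
  split.
  + by move=> u _; exact: ex_derive.
  + by apply: cvg_at_right_filter; exact: cF.
  + by apply: cvg_at_left_filter; exact: cF.
- by move=> u _; rewrite derive1E derive_val.
Qed.

(** The Poisson integral is compared with g(t) times the mass of the kernel on a window around [t].
    That mass is an arctangent tending to 2 pi / lam, so the mass outside the window is never
    computed. *)
Lemma cvg_integral_poisson : {for t, continuous g} ->
  (\int[mu]_u (g u * (2 * n.+1%:R^-1 /
     (n.+1%:R^-1 ^+ 2 + (lam * (t - u)) ^+ 2))))%R @[n --> \oo] -->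
  2 * pi / lam * g t.
Proof.
move=> cg; apply/cvgrPdist_le => eta eta0.
(* Chosen so that eta1 times the total mass 2 pi / lam is eta / 2. *)
pose eta1 := eta / 4 * (lam / pi).
have pi0 := pi_gt0 R.
have eta10 : 0 < eta1 by rewrite mulr_gt0 ?divr_gt0.
have [d d0 gd] : exists2 d : R, 0 < d & forall u, `|t - u| <= d -> `|g u - g t| <= eta1.
  move/cvgrPdist_le : cg => /(_ _ eta10)[d /= d0 h].
  exists (d / 2); first by rewrite divr_gt0.
  move=> u tu; rewrite distrC; apply: h => /=; apply: le_lt_trans tu _; lra.
pose P e u := 2 * e / (e ^+ 2 + (lam * (t - u)) ^+ 2).
pose D : set R := `[t - d, t + d].
have mD : measurable (D : set (measurableTypeR R)) by exact: measurable_itv.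
have DE u : (u \in D) = (t - d <= u <= t + d) by rewrite /D mem_setE in_itv.
pose G := (\int[mu]_u `|g u|)%R.
have G0 : 0 <= G by exact: Rintegral_ge0.
pose N e := 4 / lam * atan (lam * d / e).
have q0 (e y : R) : 0 < e -> 0 < e ^+ 2 + y ^+ 2.
  by move=> e0; rewrite ltr_pwDl ?exprn_gt0 ?sqr_ge0.
have P0 (e u : R) : 0 < e -> 0 <= P e u.
  by move=> e0; rewrite divr_ge0 ?mulr_ge0// ltW// q0.
have cP (e : R) : 0 < e -> continuous (P e).
  exact: continuous_poisson_kernel.
have mP (e : R) : 0 < e -> measurable_fun [set: R] (P e).
  by move=> e0; exact: continuous_measurable_fun (cP _ e0).
have iPD (e : R) : 0 < e -> mu.-integrable [set: R] (EFin \o (P e \_ D)).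
  move=> e0; rewrite -restrict_EFin; apply: (integrable_mkcond _ mD).1.
  apply: continuous_compact_integrable; first exact: segment_compact.
  exact: continuous_subspaceT (cP _ e0).
have IPD (e : R) : 0 < e -> (\int[mu]_u (P e \_ D) u)%R = N e.
  by move=> e0; rewrite -Rintegral_mkcond integral_poisson_near.
have igP (e : R) : 0 < e -> mu.-integrable [set: R] (EFin \o (fun u => g u * P e u)).
  move=> e0.
  apply: (integrable_dominated (g := fun u => 2 / e * `|g u|)).
  - by apply: measurable_funM => //; exact: mP.
  - move=> u; rewrite normrM mulrC ler_wpM2r// ger0_norm ?P0//.
    rewrite ler_pdivrMr ?q0// [leRHS](_ : _ = 2 * e + 2 / e * (lam * (t - u)) ^+ 2); last first.
      by field; rewrite gt_eqF.
    by rewrite lerDl mulr_ge0 ?sqr_ge0// divr_ge0// ltW.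
  - exact: integrableZl (integrable_norm gi).
(* Inside the window the oscillation of [g] is at most [eta1]. Outside, the kernel is at most 2 e /
   (lam d)^2, which is integrated against |g|. *)
have key (e : R) : 0 < e ->
   `|(\int[mu]_u (g u * P e u))%R - g t * N e| <= eta1 * N e + 2 * e / (lam * d) ^+ 2 * G.
  move=> e0.
  have i1 : mu.-integrable [set: R] (EFin \o (fun u => g t * (P e \_ D) u)).
    exact: integrableZl (iPD _ e0).
  have i2 : mu.-integrable [set: R] (EFin \o (fun u => eta1 * (P e \_ D) u)).
    exact: integrableZl (iPD _ e0).
  have i3 : mu.-integrable [set: R] (EFin \o (fun u => 2 * e / (lam * d) ^+ 2 * `|g u|)).
    exact: integrableZl (integrable_norm gi).
  have i4 := integrableB measurableT (igP _ e0) i1.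
  rewrite -(IPD _ e0) -!RintegralZl//; [|exact: integrable_norm|exact: iPD..].
  rewrite -RintegralB//; last exact: igP.
  rewrite -RintegralD//.
  apply: le_trans (le_normr_Rintegral _ _) _ => //.
  apply: le_Rintegral => //.
  - exact: integrable_norm.
  - exact: (integrableD measurableT i2 i3).
  move=> u _ /=; rewrite patchE; case: ifPn => uD.
    have tu : `|t - u| <= d.
      move: uD; rewrite DE => /andP[h1 h2].
      by rewrite ler_norml; apply/andP; split; lra.
    rewrite -mulrBl normrM (ger0_norm (P0 _ _ e0)).
    apply: le_trans (_ : eta1 * P e u <= _); first by rewrite ler_wpM2r ?P0// gd.
    by rewrite lerDl mulr_ge0// divr_ge0 ?sqr_ge0// mulr_ge0// ltW.
  rewrite !mulr0 subr0 add0r normrM mulrC ler_wpM2r// ger0_norm ?P0//.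
  have tu : d <= `|t - u|.
    rewrite leNgt; apply/negP => h; move/negP : uD; apply; rewrite DE.
    by move: h; rewrite ltr_norml => /andP[h1 h2]; apply/andP; split; lra.
  rewrite ler_wpM2l ?mulr_ge0 ?(ltW e0)//.
  rewrite lef_pV2 ?posrE ?q0 ?exprn_gt0 ?mulr_gt0//.
  apply: le_trans (_ : (lam * (t - u)) ^+ 2 <= _); last by rewrite lerDr sqr_ge0.
  have -> : (lam * (t - u)) ^+ 2 = (lam * `|t - u|) ^+ 2.
    by rewrite !exprMn real_normK ?num_real.
  by rewrite lerXn2r ?nnegrE ?mulr_ge0 ?(ltW lam0) ?(ltW d0)// ler_wpM2l// (ltW lam0).
have NN : N n.+1%:R^-1 @[n --> \oo] --> 2 * pi / lam.
  rewrite (_ : 2 * pi / lam = 4 / lam * (pi / 2)); last by field; rewrite gt_eqF.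
  apply: cvgM; first exact: cvg_cst.
  under eq_fun do rewrite invrK.
  apply: (cvg_comp (fun n => lam * d * n.+1%:R) atan); last exact: cvgy_atan.
  have h1 : (n.+1%:R : R) @[n --> \oo] --> +oo.
    by rewrite (cvg_shiftS (fun n => n%:R : R)); exact: cvgr_idn.
  have h2 : lam * d * x @[x --> +oo] --> +oo.
    by apply: gt0_cvgMry; [exact: mulr_gt0|exact: cvg_id].
  exact: (cvg_comp _ _ h1 h2).
have E0 : 2 * n.+1%:R^-1 / (lam * d) ^+ 2 * G @[n --> \oo] --> 0.
  rewrite (_ : 0 = 2 * 0 / (lam * d) ^+ 2 * G); last by rewrite mulr0 !mul0r.
  do 2 (apply: cvgM; last exact: cvg_cst).
  by apply: cvgM; [exact: cvg_cst|exact: cvg_harmonic].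
have NG : g t * N n.+1%:R^-1 @[n --> \oo] --> 2 * pi / lam * g t.
  by rewrite mulrC; apply: cvgM => //; exact: cvg_cst.
have eta4 : 0 < eta / 4 by rewrite divr_gt0.
near=> n.
have e0 : 0 < n.+1%:R^-1 :> R by rewrite invr_gt0.
have k := key _ e0.
have Nle : eta1 * N n.+1%:R^-1 <= eta / 2.
  have -> : eta / 2 = eta1 * (2 * pi / lam).
    have h (p : R) : 0 < p -> eta / 2 = eta / 4 * (lam / p) * (2 * p / lam).
      by move=> p0; field; rewrite (gt_eqF p0) (gt_eqF lam0).
    exact: h.
  rewrite ler_wpM2l ?(ltW eta10)// /N.
  rewrite (_ : 2 * pi / lam = 4 / lam * (pi / 2)); last by field; rewrite gt_eqF.
  by rewrite ler_wpM2l ?divr_ge0 ?(ltW lam0)// ltW// atan_ltpi2.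
have E : `|0 - 2 * n.+1%:R^-1 / (lam * d) ^+ 2 * G| <= eta / 4.
  by near: n; exact: (cvgrPdist_le _ _).1 E0 _ eta4.
have F : `|2 * pi / lam * g t - g t * N n.+1%:R^-1| <= eta / 4.
  by near: n; exact: (cvgrPdist_le _ _).1 NG _ eta4.
have := ler_norm (2 * n.+1%:R^-1 / (lam * d) ^+ 2 * G).
rewrite sub0r normrN in E.
set I := (\int[mu]_u _)%R; rewrite -/I in k *.
have -> : 2 * pi / lam * g t - I =
   (2 * pi / lam * g t - g t * N n.+1%:R^-1) - (I - g t * N n.+1%:R^-1) by ring.
move=> h; apply: le_trans (ler_normB _ _) _.
have sum_le (x y a b c : R) : x <= eta / 4 -> y <= a + b -> a <= eta / 2 ->
  c <= eta / 4 -> b <= c -> x + y <= eta by lra.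
exact: sum_le F k Nle E h.
Unshelve. all: end_near. Qed.

(* Abel summation turns the inverse cosine transform into convolution with the
   Poisson kernel, an approximate identity. *)
Lemma cosine_inversion : {for t, continuous g} ->
  mu.-integrable [set: R]
    (EFin \o (fun w => \int[mu]_u (g u * cos (lam * w * (t - u))))%R) ->
  lam * (\int[mu]_w \int[mu]_u (g u * cos (lam * w * (t - u))))%R = 2 * pi * g t.
Proof.
move=> cg; rewrite -/Phi => Phii.
have mPhi : measurable_fun [set: R] Phi.
  by apply/measurable_EFinP; exact: measurable_int Phii.
have ge_Phi (n : nat) (w : R) : `|expR (- (n.+1%:R^-1 * `|w|)) * Phi w| <= `|Phi w|.
  have e1 : expR (- (n.+1%:R^-1 * `|w|)) <= 1.
    by rewrite expR_le1 oppr_le0 mulr_ge0// invr_ge0.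
  by rewrite normrM ger0_norm ?expR_ge0// ler_piMl.
have ie (n : nat) : mu.-integrable [set: R]
    (EFin \o (fun w => expR (- (n.+1%:R^-1 * `|w|)) * Phi w)).
  apply: (integrable_dominated (g := fun w => `|Phi w|)).
  - apply: measurable_funM => //; apply: continuous_measurable_fun => w.
    apply: continuous_comp; last exact: continuous_expR.
    by apply: cvgN; apply: cvgM; [exact: cvg_cst|exact: norm_continuous].
  - exact: ge_Phi.
  - exact: integrable_norm.
have c1 : (\int[mu]_w (expR (- (n.+1%:R^-1 * `|w|)) * Phi w))%R @[n --> \oo] -->
    (\int[mu]_w Phi w)%R.
  apply: fine_cvg; rewrite -/(Rintegral _ _ _) EFin_Rintegral//.
  apply: (@dominated_cvg _ _ _ mu _ measurableT
    (fun n w => (expR (- (n.+1%:R^-1 * `|w|)) * Phi w)%R%:E) (EFin \o Phi)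
    (fun w => `|Phi w|%R%:E)).
  - by move=> n; exact: measurable_int (ie n).
  - move=> w _; apply: cvg_EFin; first exact: nearW.
    rewrite -[X in _ --> X]mul1r; apply: cvgM; last exact: cvg_cst.
    have h : - (n.+1%:R^-1 * `|w|) @[n --> \oo] --> (0 : R).
      rewrite -oppr0 -(mul0r `|w|); apply: cvgN; apply: cvgM; last exact: cvg_cst.
      exact: cvg_harmonic.
    rewrite -[X in _ --> X]expR0.
    by apply: continuous_cvg; [exact: continuous_expR|exact: h].
  - by [].
  - exact: integrable_norm.
  - by move=> n w _; rewrite lee_fin ge_Phi.
have c2 := cvg_integral_poisson cg.
(* The damped integrals of [Phi] and the Poisson integrals of [g] form one and the same sequence;
   uniqueness of limits identifies the two values. *)
have -> : (\int[mu]_w Phi w)%R = 2 * pi / lam * g t.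
  rewrite -(cvg_lim (@norm_hausdorff _ _) c1) -(cvg_lim (@norm_hausdorff _ _) c2).
  congr (lim (_ @ \oo)); apply/funext => n.
  by rewrite Rintegral_abel_cosine// invr_gt0.
by field; rewrite gt_eqF.
Qed.

End CosineInversion.

(** * Complex-valued integrands *)

Section ComplexConvergence.
Variables (R : realType) (T : Type) (F : set_system T).
Context {FF : Filter F}.
Implicit Types (f g : T -> R[i]) (k l : R[i]).

Definition ccvg f l : Prop :=
  (Rez (f x) @[x --> F] --> Rez l) /\ (Imz (f x) @[x --> F] --> Imz l).

Lemma ccvg_cst l : ccvg (fun=> l) l.
Proof. by split; exact: cvg_cst. Qed.

Lemma ccvg_real (f : T -> R) (l : R) : f x @[x --> F] --> l ->
  ccvg (fun x => (f x)%:C) l%:C.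
Proof. by move=> fl; split => //=; exact: cvg_cst. Qed.

Lemma ccvg_Complex (f g : T -> R) (k l : R) : f x @[x --> F] --> k ->
  g x @[x --> F] --> l -> ccvg (fun x => f x +i* g x) (k +i* l).
Proof. by move=> fk gl; split. Qed.

Lemma ccvgD f g k l : ccvg f k -> ccvg g l -> ccvg (fun x => f x + g x) (k + l).
Proof.
move=> [f1 f2] [g1 g2]; split.
  by under eq_fun do rewrite ReD; rewrite ReD; exact: cvgD.
by under eq_fun do rewrite ImD; rewrite ImD; exact: cvgD.
Qed.

Lemma ccvgN f k : ccvg f k -> ccvg (fun x => - f x) (- k).
Proof.
move=> [f1 f2]; split.
  by under eq_fun do rewrite ReN; rewrite ReN; exact: cvgN.
by under eq_fun do rewrite ImN; rewrite ImN; exact: cvgN.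
Qed.

Lemma ccvgB f g k l : ccvg f k -> ccvg g l -> ccvg (fun x => f x - g x) (k - l).
Proof. by move=> fk gl; apply: ccvgD => //; exact: ccvgN. Qed.

Lemma ccvgM f g k l : ccvg f k -> ccvg g l -> ccvg (fun x => f x * g x) (k * l).
Proof.
move=> [f1 f2] [g1 g2]; split.
  by under eq_fun do rewrite ReM; rewrite ReM; apply: cvgB; exact: cvgM.
by under eq_fun do rewrite ImM; rewrite ImM; apply: cvgD; exact: cvgM.
Qed.

Lemma ccvgX f k n : ccvg f k -> ccvg (fun x => f x ^+ n) (k ^+ n).
Proof.
move=> fk; elim: n => [|n IH]; first exact: ccvg_cst.
by rewrite exprS; under eq_fun do rewrite exprS; exact: ccvgM.
Qed.

Lemma cvg_normc f k : ccvg f k -> normc (f x) @[x --> F] --> normc k.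
Proof.
move=> [f1 f2].
have nE z : normc z = Num.sqrt (Rez z * Rez z + Imz z * Imz z) :> R.
  by case: z => a b; rewrite -!expr2.
rewrite nE; under eq_fun do rewrite nE.
apply: continuous_cvg; first exact: sqrt_continuous.
by apply: cvgD; exact: cvgM.
Qed.

Lemma ccvgV f k : k != 0 -> ccvg f k -> ccvg (fun x => (f x)^-1) k^-1.
Proof.
move=> k0 fk; have nk := cvg_normc fk; case: fk => f1 f2.
have k2 : normc k ^+ 2 != 0 by rewrite expf_neq0// normc_eq0.
have n2 : normc (f x) ^+ 2 @[x --> F] --> normc k ^+ 2.
  by rewrite expr2; under eq_fun do rewrite expr2; exact: cvgM.
split.
  rewrite ReV; under eq_fun do rewrite ReV.
  by apply: cvgM => //; exact: cvgV.
rewrite ImV; under eq_fun do rewrite ImV.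
by apply: cvgN; apply: cvgM => //; exact: cvgV.
Qed.

Lemma ccvg_cexp f k : ccvg f k -> ccvg (fun x => cexp (f x)) (cexp k).
Proof.
move=> [f1 f2].
have e : expR (Rez (f x)) @[x --> F] --> expR (Rez k).
  by apply: continuous_cvg => //; exact: continuous_expR.
split.
  rewrite Re_cexp; under eq_fun do rewrite Re_cexp.
  by apply: cvgM => //; apply: continuous_cvg => //; exact: continuous_cos.
rewrite Im_cexp; under eq_fun do rewrite Im_cexp.
by apply: cvgM => //; apply: continuous_cvg => //; exact: continuous_sin.
Qed.

(** Convergence of the argument is a separate hypothesis, since [carg] jumps across the negative
    real axis. It is verified by two different formulas: through [atan] on the right half-plane, and
    through [acos] at points of the imaginary axis. *)
Lemma ccvg_cpow f k p : k != 0 -> (forall x, f x != 0) -> ccvg f k ->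
  carg (f x) @[x --> F] --> carg k ->
  ccvg (fun x => cpow (f x) p) (cpow k p).
Proof.
move=> k0 f0 fk ck; rewrite cpowE//.
under eq_fun do rewrite cpowE//.
apply: ccvg_cexp; apply: ccvgM; first exact: ccvg_cst.
apply: ccvg_Complex => //.
apply: continuous_cvg; last exact: cvg_normc.
by apply: continuous_ln; rewrite normc_gt0.
Qed.

End ComplexConvergence.

Section ComplexMeasurability.
Variable R : realType.
Implicit Types (f g : R -> R[i]).

Definition cmeasurable f : Prop :=
  measurable_fun [set: R] (fun x => Rez (f x)) /\
  measurable_fun [set: R] (fun x => Imz (f x)).

Lemma cmeasurable_continuous f : (forall x, ccvg (nbhs x) f (f x)) -> cmeasurable f.
Proof.
move=> cf; split; apply: continuous_measurable_fun => x.
  by case: (cf x).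
by case: (cf x).
Qed.

Lemma cmeasurable_cst z : cmeasurable (fun=> z).
Proof. by split; exact: measurable_cst. Qed.

Lemma cmeasurableD f g : cmeasurable f -> cmeasurable g ->
  cmeasurable (fun x => f x + g x).
Proof.
move=> [f1 f2] [g1 g2]; split.
  by under eq_fun do rewrite ReD; exact: measurable_funD.
by under eq_fun do rewrite ImD; exact: measurable_funD.
Qed.

Lemma cmeasurableM f g : cmeasurable f -> cmeasurable g ->
  cmeasurable (fun x => f x * g x).
Proof.
move=> [f1 f2] [g1 g2]; split.
  by under eq_fun do rewrite ReM; apply: measurable_funB; exact: measurable_funM.
by under eq_fun do rewrite ImM; apply: measurable_funD; exact: measurable_funM.
Qed.

Lemma cmeasurableX f n : cmeasurable f -> cmeasurable (fun x => f x ^+ n).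
Proof.
move=> mf; elim: n => [|n IH]; first exact: cmeasurable_cst.
by under eq_fun do rewrite exprS; exact: cmeasurableM.
Qed.

Lemma cmeasurable_cexp f : cmeasurable f -> cmeasurable (fun x => cexp (f x)).
Proof.
move=> [f1 f2]; split.
  under eq_fun do rewrite Re_cexp; apply: measurable_funM.
    exact: measurableT_comp.
  apply: measurableT_comp => //; exact: continuous_measurable_fun (@continuous_cos R).
under eq_fun do rewrite Im_cexp; apply: measurable_funM.
  exact: measurableT_comp.
apply: measurableT_comp => //; exact: continuous_measurable_fun (@continuous_sin R).
Qed.

End ComplexMeasurability.

(** * Exponential families and differentiation under the integral sign *)

Section ExponentialFamily.
Variable R : realType.
Local Notation mu := (@lebesgue_measure R).
Implicit Types (A b c : R -> R[i]).

(** The common shape of the inversion integrand in the time [y] and of the rescaled one in [nu]. The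
    family is closed under d/dy, which multiplies the coefficient [c] by [b]. *)
Definition expfam c A b (y w : R) : R[i] := c w * cexp (A w + b w * y%:C).

Lemma cmeasurable_expfam c A b y : cmeasurable c -> cmeasurable A ->
  cmeasurable b -> cmeasurable (expfam c A b y).
Proof.
move=> mc mA mb; apply: cmeasurableM => //; apply: cmeasurable_cexp.
apply: cmeasurableD => //; apply: cmeasurableM => //; exact: cmeasurable_cst.
Qed.

Lemma integrable_Re_dominated (f : R -> R[i]) (g : R -> R) : cmeasurable f ->
  (forall w, normc (f w) <= g w) -> mu.-integrable [set: R] (EFin \o g) ->
  mu.-integrable [set: R] (EFin \o (fun w => Rez (f w))).
Proof.
move=> [mf _] fg; apply: integrable_dominated => // w.
exact: le_trans (abs_Re_le _) (fg w).
Qed.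

Lemma integrable_Im_dominated (f : R -> R[i]) (g : R -> R) : cmeasurable f ->
  (forall w, normc (f w) <= g w) -> mu.-integrable [set: R] (EFin \o g) ->
  mu.-integrable [set: R] (EFin \o (fun w => Imz (f w))).
Proof.
move=> [_ mf] fg; apply: integrable_dominated => // w.
exact: le_trans (abs_Im_le _) (fg w).
Qed.

Lemma is_derive_expfam c A b (w y : R) :
  is_derive y 1 (fun y => Rez (expfam c A b y w))
    (Rez (expfam (fun w => c w * b w) A b y w)).
Proof.
have E (c' : R[i]) (y' : R) : Rez (c' * cexp (A w + b w * y'%:C)) =
   expR (Rez (A w) + Rez (b w) * y') *
   (Rez c' * cos (Imz (A w) + Imz (b w) * y') -
    Imz c' * sin (Imz (A w) + Imz (b w) * y')).
  rewrite ReM Re_cexp Im_cexp ReD ImD ReM ImM /= !mulr0 subr0 add0r; ring.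
rewrite /expfam; under eq_fun do rewrite E.
rewrite E; apply: is_derive_eq.
by rewrite ReM ImM /GRing.scale /=; ring.
Qed.

Lemma is_derive_Rintegral_expfam c A b (p q : R) (g : R -> R) :
  cmeasurable c -> cmeasurable A -> cmeasurable b ->
  mu.-integrable [set: R] (EFin \o g) ->
  (forall y w, p < y < q -> normc (expfam c A b y w) <= g w) ->
  (forall y w, p < y < q -> normc (expfam (fun w => c w * b w) A b y w) <= g w) ->
  forall y, p < y < q ->
  is_derive y 1 (fun y => \int[mu]_w Rez (expfam c A b y w))%R
    (\int[mu]_w Rez (expfam (fun w => c w * b w) A b y w))%R.
Proof.
move=> mc mA mb gi h0 h1 y ypq.
have g0 w : 0 <= g w := le_trans (normc_ge0 _) (h0 y w ypq).
have d1 (y' w : R) : partial1of2 (fun y w => Rez (expfam c A b y w)) y' w =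
    Rez (expfam (fun w => c w * b w) A b y' w).
  rewrite partial1of2E; exact: (@derive_val _ _ _ _ _ _ _ (is_derive_expfam c A b w y')).
have ypq' : (`]p, q[ : set R) y by rewrite /= in_itv.
have intf (x : R) : (`]p, q[ : set R) x ->
    mu.-integrable [set: R] (EFin \o (fun w => Rez (expfam c A b x w))).
  rewrite /= in_itv/= => xI; apply: integrable_Re_dominated gi.
    exact: cmeasurable_expfam.
  by move=> w; exact: h0.
have der (x w : R) : (`]p, q[ : set R) x -> [set: R] w ->
    derivable (fun y => Rez (expfam c A b y w)) x 1.
  by move=> _ _; exact: (@ex_derive _ _ _ _ _ _ _ (is_derive_expfam c A b w x)).
have bnd (x w : R) : (`]p, q[ : set R) x -> [set: R] w ->
    `|partial1of2 (fun y w => Rez (expfam c A b y w)) x w| <= g w.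
  rewrite /= in_itv/= => xI _; rewrite d1.
  exact: le_trans (abs_Re_le _) (h1 _ _ xI).
apply: DeriveDef.
  exact: (derivable_under_integral measurableT ypq' intf der g0 gi bnd).
rewrite -derive1E.
rewrite (differentiation_under_integral measurableT ypq' intf der g0 gi bnd).
by apply: eq_Rintegral => w _; exact: d1.
Qed.

End ExponentialFamily.

(** * The rescaled Bromwich integral *)

(** Makes the continuity of the argument on the right half-plane evident. *)
Lemma carg_atan (R : realType) (s : R[i]) : 0 < Rez s -> carg s = atan (Imz s / Rez s).
Proof.
move=> s0.
have sn0 : s != 0 by apply: contraTneq s0 => ->; rewrite ltxx.
have n0 : 0 < normc s by rewrite normc_gt0.
have := abs_carg_le (ltW s0); rewrite ler_norml => /andP[h1 h2].
have c0 : 0 < cos (carg s) by rewrite cos_carg divr_gt0.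
have -> : Imz s / Rez s = tan (carg s).
  by rewrite /tan sin_carg// cos_carg; field; rewrite !gt_eqF.
rewrite tanK// in_itv/= !lt_neqAle h1 h2 !andbT; apply/andP; split.
  by apply: contraTneq c0 => <-; rewrite cosN cos_pihalf ltxx.
by apply: contraTneq c0 => ->; rewrite cos_pihalf ltxx.
Qed.

Section ContourIntegrals.
Variables (R : realType) (alpha tau : R).
Hypotheses (halpha : 0 < alpha < 1) (htau : 0 < tau < 1).
Implicit Types (t w nu : R).
Local Notation mu := (@lebesgue_measure R).

Definition contour_l t w : R[i] := zener_l alpha tau (contour alpha t w).

(** With x = t + nu t^(1/(1+alpha)), the exponent s t - x s l(s) is affine in [nu]: this is the
    constant term, and [slope] is the coefficient of [nu]. *)
Definition phase t w : R[i] := t%:C * contour alpha t w * (1 - contour_l t w).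

Definition slope t w : R[i] :=
  - ((t `^ (1 / (1 + alpha)))%:C * contour alpha t w * contour_l t w).

Lemma Re_cpow_contour_ge0 t w : 1 <= t -> 0 <= Rez (cpow (contour alpha t w) alpha).
Proof.
by move=> t1; apply: Re_cpow_ge0 => //; [exact/ltW/Re_contour_gt0|exact: contour_neq0].
Qed.

Lemma ccvg_contour t w : ccvg (nbhs w) (contour alpha t) (contour alpha t w).
Proof.
apply: ccvg_Complex; first exact: cvg_cst.
by apply: cvgM; [exact: cvg_cst|exact: cvg_id].
Qed.

Lemma ccvg_cpow_contour t w : 1 <= t ->
  ccvg (nbhs w) (fun w => cpow (contour alpha t w) alpha)
    (cpow (contour alpha t w) alpha).
Proof.
move=> t1; apply: ccvg_cpow.
- exact: contour_neq0.
- by move=> x; exact: contour_neq0.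
- exact: ccvg_contour.
- rewrite carg_atan ?Re_contour_gt0//.
  under eq_fun do rewrite carg_atan ?Re_contour_gt0//.
  apply: continuous_cvg; first exact: continuous_atan.
  rewrite /=; apply: cvgM; last exact: cvg_cst.
  by apply: cvgM; [exact: cvg_cst|exact: cvg_id].
Qed.

(** Continuity of the root is read off Re l = sqrt((|u| + Re u) / 2) and Im l = Im u / (2 Re l),
    where u = l^2 and Re l > 0. *)
Lemma ccvg_contour_l t w : 1 <= t -> ccvg (nbhs w) (contour_l t) (contour_l t w).
Proof.
move=> t1.
pose u w := (1 + tau%:C * cpow (contour alpha t w) alpha) /
            (1 + cpow (contour alpha t w) alpha).
have cz := ccvg_cpow_contour w t1.
have z0 x := Re_cpow_contour_ge0 x t1.
have cu : ccvg (nbhs w) u (u w).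
  apply: ccvgM.
    by apply: ccvgD; [exact: ccvg_cst|apply: ccvgM => //; exact: ccvg_cst].
  apply: ccvgV; first exact: oneD_neq0.
  by apply: ccvgD => //; exact: ccvg_cst.
have ReE x : Rez (contour_l t x) = Num.sqrt ((normc (u x) + Rez (u x)) / 2).
  by rewrite /contour_l /zener_l -/(u x); case: (u x).
have l0 x : 0 < Rez (contour_l t x) by exact: Re_zener_root_gt0.
have ImE x : Imz (contour_l t x) = Imz (u x) / (2 * Rez (contour_l t x)).
  have <- : contour_l t x ^+ 2 = u x by exact: sqr_sqrtc.
  move: (l0 x); rewrite expr2 ImM; move: (Rez _) (Imz _) => p q p0.
  by field; rewrite gt_eqF.
have cR : Rez (contour_l t x) @[x --> w] --> Rez (contour_l t w).
  rewrite ReE; under eq_fun do rewrite ReE.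
  apply: continuous_cvg; first exact: sqrt_continuous.
  apply: cvgM; last exact: cvg_cst.
  by apply: cvgD; [exact: cvg_normc|case: cu].
split => //.
rewrite ImE; under eq_fun do rewrite ImE.
apply: cvgM; first by case: cu.
apply: cvgV; first by rewrite gt_eqF// mulr_gt0.
by apply: cvgM => //; exact: cvg_cst.
Qed.

Lemma cmeasurable_contour t : cmeasurable (contour alpha t).
Proof. by apply: cmeasurable_continuous => w; exact: ccvg_contour. Qed.

Lemma cmeasurable_contour_l t : 1 <= t -> cmeasurable (contour_l t).
Proof. by move=> t1; apply: cmeasurable_continuous => w; exact: ccvg_contour_l. Qed.

Lemma cmeasurable_phase t : 1 <= t -> cmeasurable (phase t).
Proof.
move=> t1; apply: cmeasurable_continuous => w; apply: ccvgM.
  by apply: ccvgM; [exact: ccvg_cst|exact: ccvg_contour].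
by apply: ccvgB; [exact: ccvg_cst|exact: ccvg_contour_l].
Qed.

Lemma cmeasurable_slope t : 1 <= t -> cmeasurable (slope t).
Proof.
move=> t1; apply: cmeasurable_continuous => w; apply: ccvgN; apply: ccvgM.
  by apply: ccvgM; [exact: ccvg_cst|exact: ccvg_contour].
exact: ccvg_contour_l.
Qed.

Lemma normc_contour_l_le1 t w : 1 <= t -> normc (contour_l t w) <= 1.
Proof.
by move=> t1; apply: normc_zener_root_le1 => //; exact: Re_cpow_contour_ge0.
Qed.

Lemma normc_slope_le t w : 1 <= t -> normc (slope t w) <= 1 + `|w|.
Proof.
move=> t1; have t0 : 0 < t by exact: lt_le_trans t1.
rewrite /slope normcN normcM; apply: le_trans (_ : (1 + `|w|) * 1 <= _); last by rewrite mulr1.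
apply: ler_pM; rewrite ?normc_ge0 ?normc_contour_l_le1//.
rewrite normcM normcR ger0_norm ?powR_ge0//.
have E : t `^ (1 / (1 + alpha)) * t `^ (- (1 / (1 + alpha))) = 1.
  by rewrite -powRD ?subrr ?powRr0// (gt_eqF t0) implybT.
apply: le_trans (_ : t `^ (1 / (1 + alpha)) * (t `^ (- (1 / (1 + alpha))) * (1 + `|w|)) <= _).
  apply: ler_wpM2l; first exact: powR_ge0.
  apply: le_trans (normc_le_ReIm _) _; rewrite mulrDr mulr1 lerD//=.
    by rewrite ger0_norm ?invr_ge0 ?exprn_ge0 ?(ltW t0)// invr_sqr_le_contour_scale.
  by rewrite normrM ger0_norm ?powR_ge0.
by rewrite mulrA E mul1r.
Qed.

Lemma phase_slopeE t nu w : phase t w + slope t w * nu%:C =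
  contour alpha t w * t%:C -
  (t + nu * t `^ (1 / (1 + alpha)))%:C * contour alpha t w * contour_l t w.
Proof. by rewrite /phase /slope rmorphD rmorphM /=; ring. Qed.

Lemma normc_cexp_phase_le t nu w : 1 <= t ->
  t / 2 <= t + nu * t `^ (1 / (1 + alpha)) ->
  normc (cexp (phase t w + slope t w * nu%:C)) <= expR 1 * decay alpha tau w.
Proof.
move=> t1 ht; have t0 : 0 < t by exact: lt_le_trans t1.
rewrite normc_cexp phase_slopeE -mulrA ReD ReN [Rez (_ * t%:C)]ReM [Rez (_%:C * _)]ReM.
rewrite [Rez (_%:C)]/= [Imz (_%:C)]/= mulr0 mul0r !subr0 expRD.
apply: ler_pM; rewrite ?expR_ge0//; last first.
  exact: expR_zener_l_le_decay.
(* The abscissa contributes exp(t * t^-2), at most exp 1 since t >= 1. *)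
rewrite [Rez _]/= ler_expR -[leLHS]/(t ^- 2 * t).
rewrite ler_pdivrMl ?exprn_gt0// mulr1 expr2.
by rewrite ler_peMl// ltW.
Qed.

Definition kernel_integrand n t nu w : R[i] :=
  expfam (fun w => contour_l t w * slope t w ^+ n) (phase t) (slope t) nu w.

Lemma cmeasurable_kernel_integrand n t nu : 1 <= t ->
  cmeasurable (kernel_integrand n t nu).
Proof.
move=> t1; apply: cmeasurable_expfam.
- apply: cmeasurableM; first exact: cmeasurable_contour_l.
  exact/cmeasurableX/cmeasurable_slope.
- exact: cmeasurable_phase.
- exact: cmeasurable_slope.
Qed.

Lemma kernel_integrand_bound n : exists2 C : R, 0 <= C &
  forall t nu w, 1 <= t -> t / 2 <= t + nu * t `^ (1 / (1 + alpha)) ->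
  normc (kernel_integrand n t nu w) <= C * (1 + w ^+ 2)^-1.
Proof.
have [C C0 hC] := decay_polynomial halpha htau n.
exists (expR 1 * C); first by rewrite mulr_ge0 ?expR_ge0.
move=> t nu w t1 ht.
rewrite -mulrA; apply: le_trans (ler_wpM2l (expR_ge0 1) (hC w)).
rewrite /kernel_integrand /expfam normcM mulrCA.
apply: ler_pM; rewrite ?normc_ge0//; last exact: normc_cexp_phase_le.
rewrite normcM -[leRHS]mul1r.
apply: ler_pM; rewrite ?normc_ge0 ?normc_contour_l_le1// normcX.
by rewrite lerXn2r ?nnegrE ?normc_ge0 ?addr_ge0// normc_slope_le.
Qed.

(** The candidate for the n-th derivative in [nu]. The constant 1 / (4 pi) is 1 / (2 pi) from the
    inversion times the 1 / 2 in [zener_Stilde]. *)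
Definition kernel_integral n t nu : R :=
  (4 * pi)^-1 * (\int[mu]_w Rez (kernel_integrand n t nu w))%R.

Lemma integrable_scaled_inv1Dsqr (C : R) :
  mu.-integrable [set: R] (EFin \o (fun w => C * (1 + w ^+ 2)^-1)).
Proof. exact: integrableZl (integrable_inv1Dsqr R). Qed.

Lemma is_derive_kernel_integral n t nu : 1 <= t ->
  t / 2 < t + nu * t `^ (1 / (1 + alpha)) ->
  is_derive nu 1 (kernel_integral n t) (kernel_integral n.+1 t nu).
Proof.
move=> t1 ht; have t0 : 0 < t by exact: lt_le_trans t1.
have tb : 0 < t `^ (1 / (1 + alpha)) by exact: powR_gt0.
have [C C0 hC] := kernel_integrand_bound n.
have [C' C'0 hC'] := kernel_integrand_bound n.+1.
(* The value of [nu] at which x = t / 2; the upper end nu + 1 of the interval is arbitrary. *)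
pose p := - (t / 2) / t `^ (1 / (1 + alpha)).
have hp y : p < y -> t / 2 <= t + y * t `^ (1 / (1 + alpha)).
  by rewrite /p ltr_pdivrMr// => h; lra.
have pnu : p < nu < nu + 1.
  by rewrite /p ltr_pdivrMr//; apply/andP; split; lra.
have i0 (w : R) : 0 <= (1 + w ^+ 2)^-1 by rewrite invr_ge0 addr_ge0// sqr_ge0.
have E m y w : expfam (fun w => contour_l t w * slope t w ^+ m * slope t w)
    (phase t) (slope t) y w = kernel_integrand m.+1 t y w.
  by rewrite /kernel_integrand /expfam exprSr mulrA.
have D := @is_derive_Rintegral_expfam R
  (fun w => contour_l t w * slope t w ^+ n) (phase t) (slope t) p (nu + 1)
  (fun w => (C + C') * (1 + w ^+ 2)^-1).
have {}D : is_derive nu 1 (fun y => (\int[mu]_w Rez (kernel_integrand n t y w))%R)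
   (\int[mu]_w Rez (kernel_integrand n.+1 t nu w))%R.
  have -> : (\int[mu]_w Rez (kernel_integrand n.+1 t nu w))%R =
    (\int[mu]_w Rez (expfam (fun w => contour_l t w * slope t w ^+ n * slope t w)
      (phase t) (slope t) nu w))%R by apply: eq_Rintegral => w _; rewrite E.
  apply: D => //.
  - apply: cmeasurableM; first exact: cmeasurable_contour_l.
    exact/cmeasurableX/cmeasurable_slope.
  - exact: cmeasurable_phase.
  - exact: cmeasurable_slope.
  - exact: integrable_scaled_inv1Dsqr.
  - move=> y w /andP[py _]; apply: le_trans (hC _ _ _ t1 (hp _ py)) _.
    by rewrite ler_wpM2r// lerDl.
  - move=> y w /andP[py _]; rewrite E; apply: le_trans (hC' _ _ _ t1 (hp _ py)) _.
    by rewrite ler_wpM2r// lerDr.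
exact: is_deriveZ.
Qed.

Lemma kernel_integral_bound n : exists2 M : R, 0 <= M &
  forall t nu, 1 <= t -> t / 2 <= t + nu * t `^ (1 / (1 + alpha)) ->
  `|kernel_integral n t nu| <= M.
Proof.
have [C C0 hC] := kernel_integrand_bound n.
have pi0 : 0 <= (4 * pi)^-1 :> R by rewrite invr_ge0 mulr_ge0// pi_ge0.
have i0 (w : R) : 0 <= (1 + w ^+ 2)^-1 by rewrite invr_ge0 addr_ge0// sqr_ge0.
exists ((4 * pi)^-1 * (\int[mu]_w (C * (1 + w ^+ 2)^-1))%R).
  by rewrite mulr_ge0//; apply: Rintegral_ge0 => w _; rewrite mulr_ge0.
move=> t nu t1 ht; rewrite normrM ger0_norm// ler_wpM2l//.
have ii : mu.-integrable [set: R] (EFin \o (fun w => Rez (kernel_integrand n t nu w))).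
  apply: integrable_Re_dominated (integrable_scaled_inv1Dsqr C).
    exact: cmeasurable_kernel_integrand.
  by move=> w; exact: hC.
apply: le_trans (le_normr_Rintegral measurableT ii) _.
apply: le_Rintegral => //.
- exact: integrable_norm.
- exact: integrable_scaled_inv1Dsqr.
- by move=> w _; apply: le_trans (abs_Re_le _) (hC _ _ _ t1 ht).
Qed.

End ContourIntegrals.

(** * Large-time limit *)

Section Preliminaries.
Variable R : realType.
Local Notation mu := (@lebesgue_measure R).

Lemma cvgy_powRN (p : R) : 0 < p -> t `^ (- p) @[t --> +oo] --> (0 : R).
Proof.
move=> p0.
apply/cvgrPdist_le => e e0; near=> t.
have tp : e `^ (- p^-1) <= t by near: t; exact: nbhs_pinfty_ge.
have t0 : 0 < t by apply: lt_le_trans tp; exact: powR_gt0.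
rewrite sub0r normrN ger0_norm ?powR_ge0// powRN.
rewrite -[leRHS]invrK lef_pV2 ?posrE ?powR_gt0 ?invr_gt0//.
have : (e `^ (- p^-1)) `^ p <= t `^ p.
  by apply: ge0_ler_powR; rewrite ?nnegrE ?powR_ge0 ?(ltW p0) ?(ltW t0).
by rewrite -powRrM mulNr mulVf ?gt_eqF// powR_inv1 ?(ltW e0).
Unshelve. all: end_near. Qed.

(** Dominated convergence works along sequences and wants the bound for every term, while the bounds
    here need t >= T. Replacing a sequence by its maximum with [T] changes only finitely many
    terms. *)
Lemma cvg_pinfty_threshold (f : R -> R) (l T : R) :
  (forall u : nat -> R, (forall k, T <= u k) -> u k @[k --> \oo] --> +oo ->
     f (u k) @[k --> \oo] --> l) ->
  f t @[t --> +oo] --> l.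
Proof.
move=> H; apply/cvg_pinftyP => u uy.
have vy : Num.max T (u k) @[k --> \oo] --> +oo.
  apply/cvgryPge => A; move/cvgryPge : uy => /(_ A); apply: filterS => k Ak.
  by rewrite le_max Ak orbT.
have Tv k : T <= Num.max T (u k) by rewrite le_max lexx.
have := H _ Tv vy; apply: cvg_trans.
apply: near_eq_cvg; near=> k; congr f; apply/max_idPr.
by near: k; move/cvgryPge : uy => /(_ T).
Unshelve. all: end_near. Qed.

(** The null set {0} is exempted because at w = 0 the rescaled contour runs into the branch point of
    the power. *)
Lemma dominated_cvg_Rintegral (f_ : nat -> R -> R) (f g : R -> R) :
  (forall k, measurable_fun [set: R] (f_ k)) -> measurable_fun [set: R] f ->
  (forall w, w != 0 -> f_ k w @[k --> \oo] --> f w) ->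
  mu.-integrable [set: R] (EFin \o g) ->
  (forall k w, `|f_ k w| <= g w) ->
  (\int[mu]_w f_ k w)%R @[k --> \oo] --> (\int[mu]_w f w)%R.
Proof.
move=> mf_ mf cf gi fg.
have i_ k : mu.-integrable [set: R] (EFin \o f_ k).
  exact: integrable_dominated gi.
have aecf : {ae mu, forall w, [set: R] w ->
    (f_ k w)%:E @[k --> \oo] --> (EFin \o f) w}.
  exists [set (0 : R)]; split; [exact: measurable_set1|exact: lebesgue_measure_set1|].
  move=> w /= nw; apply: contrapT => w0; apply: nw => _.
  by apply: cvg_EFin; [exact: nearW|apply: cf; exact/eqP].
have aefg : {ae mu, forall w, forall k, [set: R] w ->
    (`|(f_ k w)%:E| <= (EFin \o g) w)%E}.
  by apply: aeW => w k _; rewrite /= lee_fin.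
have mE k : measurable_fun [set: R] (fun w => (f_ k w)%:E) by exact/measurable_EFinP.
have mfE : measurable_fun [set: R] (EFin \o f) by exact/measurable_EFinP.
have [fi _ h] := @dominated_convergence _ (measurableTypeR R) R mu setT
  measurableT _ _ _ mE mfE aecf gi aefg.
by apply: fine_cvg; rewrite EFin_Rintegral.
Qed.

Lemma ccvg_normc0 (T : Type) (F : set_system T) {FF : Filter F} (f : T -> R[i]) l :
  normc (f x - l) @[x --> F] --> (0 : R) -> ccvg F f l.
Proof.
move=> h; split.
  apply/subr_cvg0; apply: norm_cvg0.
  apply: (@squeeze_cvgr _ _ _ _ (cst 0) (fun x => normc (f x - l))) => //.
    by apply: nearW => x; rewrite normr_ge0/= -ReN -ReD abs_Re_le.
  exact: cvg_cst.
apply/subr_cvg0; apply: norm_cvg0.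
apply: (@squeeze_cvgr _ _ _ _ (cst 0) (fun x => normc (f x - l))) => //.
  by apply: nearW => x; rewrite normr_ge0/= -ImN -ImD abs_Im_le.
exact: cvg_cst.
Qed.

Lemma iM_neq0 (w : R) : w != 0 -> 'i%C * w%:C != 0 :> R[i].
Proof. by move=> w0; rewrite -normc_eq0 normc_iM normr_eq0. Qed.

Lemma Re_iM (w : R) : Rez ('i%C * w%:C) = 0.
Proof. by rewrite ReM /= mul0r mul1r subr0. Qed.

Lemma Im_iM (w : R) : Imz ('i%C * w%:C) = w.
Proof. by rewrite ImM /= mul0r mul1r add0r. Qed.

Lemma carg_iM (w : R) : carg ('i%C * w%:C) = (if w < 0 then -1 else 1) * (pi / 2).
Proof. by rewrite /carg Re_iM Im_iM mul0r acos0. Qed.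

Lemma cpow_iM (p w : R) : p != 0 -> cpow ('i%C * w%:C) p =
  (`|w| `^ p * cos (p * (pi / 2))) +i*
  ((if w < 0 then -1 else 1) * (`|w| `^ p * sin (p * (pi / 2)))).
Proof.
move=> p0; have [->|w0] := eqVneq w 0.
  rewrite mulr0 /cpow eqxx (negPf p0) normr0 powR0// !mul0r mulr0.
  by apply: eq_ReIm.
have z0 := iM_neq0 w0.
apply: eq_ReIm; rewrite ?Re_cpow ?Im_cpow// normc_iM carg_iM /=.
  by case: ifP => _; rewrite ?mulN1r ?mul1r ?mulrN ?cosN.
by case: ifP => _; rewrite ?mulN1r ?mul1r ?mulrN ?sinN ?mulrN.
Qed.

End Preliminaries.

Section LargeTime.
Variables (R : realType) (alpha tau : R).
Hypotheses (halpha : 0 < alpha < 1) (htau : 0 < tau < 1).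
Implicit Types (t w nu : R).
Local Notation mu := (@lebesgue_measure R).
Local Notation beta := (1 / (1 + alpha)).

(** The variable zeta = t^(1/(1+alpha)) s; its real part tends to 0 because 1/(1+alpha) < 2. *)
Definition scaled_contour t w : R[i] := (t `^ (beta - 2)) +i* w.

Lemma contour_scaled t w : 0 < t ->
  contour alpha t w = (t `^ (- beta))%:C * scaled_contour t w.
Proof.
move=> t0; apply: eq_ReIm; rewrite ?ReM ?ImM /= !mul0r ?subr0 ?addr0//.
rewrite -powRD ?(gt_eqF t0) ?implybT//.
by rewrite addrA addNr add0r powR_invn// ltW.
Qed.

Definition limit_phase w : R[i] :=
  ((1 - tau) / 2)%:C * cpow ('i%C * w%:C) (1 + alpha).

Definition limit_slope w : R[i] := - ('i%C * w%:C).

Definition limit_integrand n nu w : R[i] :=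
  expfam (fun w => limit_slope w ^+ n) limit_phase limit_slope nu w.

Section PointwiseLimit.
Variables (u : nat -> R) (w : R).
Hypotheses (u1 : forall k, 1 <= u k) (uy : u k @[k --> \oo] --> +oo) (w0 : w != 0).

Let z k := cpow (contour alpha (u k) w) alpha.
Let l k := contour_l alpha tau (u k) w.

Let u0 k : 0 < u k.
Proof. exact: lt_le_trans (u1 k). Qed.

Let zeta_neq0 k : scaled_contour (u k) w != 0.
Proof. by rewrite eq_complex /= negb_and w0 orbT. Qed.

Let ccvg_zeta : ccvg \oo (fun k => scaled_contour (u k) w) ('i%C * w%:C).
Proof.
have /andP[a0 a1] := halpha.
split; rewrite ?Re_iM ?Im_iM /=; last exact: cvg_cst.
have p0 : 0 < 2 - beta.
  by rewrite subr_gt0 ltr_pdivrMr; lra.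
have := (cvg_pinftyP _ _).1 (cvgy_powRN p0) _ uy.
by rewrite opprB.
Qed.

Let ccvg_cpow_zeta :
  ccvg \oo (fun k => cpow (scaled_contour (u k) w) alpha) (cpow ('i%C * w%:C) alpha).
Proof.
apply: ccvg_cpow; [exact: iM_neq0|exact: zeta_neq0|exact: ccvg_zeta|].
(* Along the sequence the imaginary part is the constant [w], so the sign in [carg] never changes
   and only the continuity of [acos] at 0 is involved. *)
have -> : carg ('i%C * w%:C) = (if w < 0 then -1 else 1) *
    acos (Rez ('i%C * w%:C) / normc ('i%C * w%:C)) by rewrite /carg Im_iM.
rewrite (_ : (fun k => _) = fun k => (if w < 0 then -1 else 1) *
    acos (Rez (scaled_contour (u k) w) / normc (scaled_contour (u k) w)))//.
apply: cvgM; first exact: cvg_cst.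
have nw : normc ('i%C * w%:C) != 0 by rewrite normc_eq0 iM_neq0.
apply: continuous_cvg.
  by apply: continuous_acos; rewrite Re_iM mul0r; lra.
apply: cvgM; first by case: ccvg_zeta.
by apply: cvgV => //; exact: cvg_normc ccvg_zeta.
Qed.

Let zE k : z k = ((u k `^ (- beta)) `^ alpha)%:C * cpow (scaled_contour (u k) w) alpha.
Proof. by rewrite /z contour_scaled// cpow_scale// powR_gt0. Qed.

Let ccvg_z : ccvg \oo z 0.
Proof.
have /andP[a0 a1] := halpha.
rewrite (_ : z = fun k => ((u k `^ (- beta)) `^ alpha)%:C *
  cpow (scaled_contour (u k) w) alpha); last by apply/funext.
rewrite -(mul0r (cpow ('i%C * w%:C) alpha)); apply: ccvgM => //.
apply: ccvg_real; under eq_fun do rewrite -powRrM mulNr.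
have p0 : 0 < beta * alpha by rewrite mulr_gt0// divr_gt0//; lra.
exact: (cvg_pinftyP _ _).1 (cvgy_powRN p0) _ uy.
Qed.

Let z_ge0 k : 0 <= Rez (z k).
Proof. exact: Re_cpow_contour_ge0. Qed.

(** This is 1 - l^2. As |1 + l| >= 1, it yields l -> 1, and dividing by 1 + l gives the exact form
    of 1 - l used for the phase. *)
Let oneBl k : (1 - l k) * (1 + l k) = (1 - tau)%:C * z k / (1 + z k).
Proof.
rewrite -oneB_zener_quotient//.
have -> : (1 + tau%:C * z k) / (1 + z k) = l k ^+ 2.
  by rewrite /l /contour_l /zener_l sqr_sqrtc.
ring.
Qed.

Let l_gt0 k : 0 < Rez (l k).
Proof. by have := Re_zener_root_gt0 htau (z_ge0 k). Qed.

Let oneDl_ge1 k : 1 <= normc (1 + l k).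
Proof. exact: normc_1D_ge1 (ltW (l_gt0 k)). Qed.

Lemma ccvg_contour_l_pinfty : ccvg \oo (fun k => contour_l alpha tau (u k) w) 1.
Proof.
apply: ccvg_normc0.
pose q k := (1 - tau)%:C * z k / (1 + z k).
have cq : ccvg \oo q 0.
  rewrite -(mul0r (1 + 0)^-1) -[X in X / _](mulr0 (1 - tau)%:C).
  apply: ccvgM; first by apply: ccvgM => //; exact: ccvg_cst.
  apply: ccvgV; first by rewrite addr0 oner_eq0.
  by apply: ccvgD => //; exact: ccvg_cst.
have nq : normc (q k) @[k --> \oo] --> (0 : R).
  by rewrite -(ComplexField.Normc.normc0 R); exact: cvg_normc.
apply: (@squeeze_cvgr _ _ _ _ (cst 0) (fun k => normc (q k))) => //; last exact: cvg_cst.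
apply: nearW => k; rewrite normc_ge0/= /q -oneBl normcM -normcN opprB.
by rewrite ler_peMr ?normc_ge0.
Qed.

(** Substituting 1 - l = (1 - tau) z / ((1 + z)(1 + l)) and s = t^(-beta) zeta leaves (1 - tau)
    zeta^(1+alpha) / ((1 + z)(1 + l)). The denominator tends to 2, whence the constant (1 - tau) /
    2. *)
Lemma ccvg_phase_pinfty : ccvg \oo (fun k => phase alpha tau (u k) w) (limit_phase w).
Proof.
have /andP[a0 a1] := halpha.
have E k : phase alpha tau (u k) w =
    (1 - tau)%:C * (scaled_contour (u k) w * cpow (scaled_contour (u k) w) alpha) /
      ((1 + z k) * (1 + l k)).
  have z1 : 1 + z k != 0 by exact: oneD_neq0.
  have l1 : 1 + l k != 0 by rewrite -normc_gt0 (lt_le_trans ltr01).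
  rewrite /phase -/(l k).
  have -> : 1 - l k = (1 - tau)%:C * z k / (1 + z k) / (1 + l k).
    by rewrite -oneBl mulfK.
  rewrite zE contour_scaled//.
  (* All powers of t cancel, 1 - beta - alpha beta being 0: this is what singles out the scale beta
     = 1/(1+alpha). *)
  have P : u k * u k `^ (- beta) * (u k `^ (- beta)) `^ alpha = 1.
    rewrite -{1}(powRr1 (ltW (u0 k))) -powRrM -!powRD ?(gt_eqF (u0 k)) ?implybT//.
    rewrite (_ : 1 + - beta + - beta * alpha = 0) ?powRr0//.
    by field; lra.
  have {}P : (u k)%:C * (u k `^ (- beta))%:C * ((u k `^ (- beta)) `^ alpha)%:C = 1.
    by rewrite -!rmorphM/= P.
  rewrite -[RHS]mul1r -P invfM; ring.
under eq_fun do rewrite E.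
have -> : limit_phase w = (1 - tau)%:C * ('i%C * w%:C * cpow ('i%C * w%:C) alpha) /
    ((1 + 0) * (1 + 1)).
  rewrite /limit_phase cpowD ?iM_neq0// cpow1 ?iM_neq0// addr0 mul1r.
  have -> : ((1 - tau) / 2)%:C = (1 - tau)%:C / (1 + 1) :> R[i].
    by rewrite rmorphM fmorphV rmorph_nat.
  ring.
apply: ccvgM.
  apply: ccvgM; first exact: ccvg_cst.
  by apply: ccvgM; [exact: ccvg_zeta|exact: ccvg_cpow_zeta].
apply: ccvgV; first by rewrite addr0 mul1r -(natrD _ 1 1) pnatr_eq0.
apply: ccvgM; first by apply: ccvgD => //; exact: ccvg_cst.
by apply: ccvgD; [exact: ccvg_cst|exact: ccvg_contour_l_pinfty].
Qed.

Lemma ccvg_slope_pinfty : ccvg \oo (fun k => slope alpha tau (u k) w) (limit_slope w).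
Proof.
have E k : slope alpha tau (u k) w = - (scaled_contour (u k) w * l k).
  rewrite /slope contour_scaled// mulrA.
  have P : (u k `^ beta)%:C * (u k `^ (- beta))%:C = 1.
    by rewrite -rmorphM/= -powRD ?subrr ?powRr0// (gt_eqF (u0 k)) implybT.
  by rewrite P mul1r.
under eq_fun do rewrite E.
rewrite /limit_slope -[X in - X]mulr1; apply: ccvgN; apply: ccvgM.
  exact: ccvg_zeta.
exact: ccvg_contour_l_pinfty.
Qed.

Lemma ccvg_kernel_integrand_pinfty n nu :
  ccvg \oo (fun k => kernel_integrand alpha tau n (u k) nu w) (limit_integrand n nu w).
Proof.
rewrite /limit_integrand /expfam -[limit_slope w ^+ n]mul1r.
apply: ccvgM.
  apply: ccvgM; first exact: ccvg_contour_l_pinfty.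
  by apply: ccvgX; exact: ccvg_slope_pinfty.
apply: ccvg_cexp; apply: ccvgD; first exact: ccvg_phase_pinfty.
by apply: ccvgM; [exact: ccvg_slope_pinfty|exact: ccvg_cst].
Qed.

End PointwiseLimit.

End LargeTime.

(** * The limit profile, its derivatives and its integral representation *)

Section LimitIntegral.
Variables (R : realType) (alpha tau : R).
Hypotheses (halpha : 0 < alpha < 1) (htau : 0 < tau < 1).
Implicit Types (t w nu : R).
Local Notation mu := (@lebesgue_measure R).
Local Notation beta := (1 / (1 + alpha)).

(** As beta < 1, the term nu t^beta is negligible against t, uniformly for bounded [nu]. The strict
    inequality defines an open set of [nu], on which one can differentiate. *)
Lemma large_time_threshold (M : R) : exists2 T : R, 1 <= T &
  forall t nu, T <= t -> `|nu| <= M -> t / 2 < t + nu * t `^ beta.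
Proof.
have /andP[a0 a1] := halpha.
have p0 : 0 < 1 - beta by rewrite subr_gt0 ltr_pdivrMr; lra.
pose e := (2 * (`|M| + 1))^-1.
have M1 : 0 < `|M| + 1 by rewrite ltr_pwDr.
have e0 : 0 < e by rewrite invr_gt0 mulr_gt0.
have := (cvgrPdist_lt _ _).1 (cvgy_powRN p0) e e0.
move=> [T0 [_ hT]].
exists (Num.max 1 (T0 + 1)); first by rewrite le_max lexx.
move=> t nu; rewrite ge_max => /andP[t1 tT] nuM.
have t0 : 0 < t by exact: lt_le_trans t1.
have : `|0 - t `^ (- (1 - beta))| < e by apply: hT; lra.
rewrite sub0r normrN ger0_norm ?powR_ge0// opprB powRB ?(gt_eqF t0) ?implybT//.
rewrite powRr1 ?(ltW t0)// ltr_pdivrMr// => h.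
have h2 : (`|M| + 1) * t `^ beta < t / 2.
  rewrite -ltr_pdivlMl// (lt_le_trans h)// /e le_eqVlt; apply/orP; left.
  by apply/eqP; field; rewrite gt_eqF.
have h3 : - (nu * t `^ beta) <= (`|M| + 1) * t `^ beta.
  rewrite -mulNr ler_wpM2r ?powR_ge0//.
  have : - nu <= `|nu| by rewrite -normrN ler_norm.
  have := ler_norm M; lra.
lra.
Qed.

Lemma cmeasurable_limit_slope : cmeasurable (@limit_slope R).
Proof.
apply: cmeasurable_continuous => w; apply: ccvgN; apply: ccvgM; first exact: ccvg_cst.
by apply: ccvg_real; exact: cvg_id.
Qed.

Lemma cmeasurable_limit_phase : cmeasurable (limit_phase alpha tau).
Proof.
have /andP[a0 a1] := halpha.
have p0 : 1 + alpha != 0 by rewrite gt_eqF// addr_gt0.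
apply: cmeasurableM; first exact: cmeasurable_cst.
(* Absorbs the sign into a factor [w], which turns the imaginary part into a product of measurable
   functions. *)
have E w : (if w < 0 then -1 else 1) * `|w| `^ (1 + alpha) = w * `|w| `^ alpha.
  have [->|w0] := eqVneq w 0; first by rewrite normr0 powR0// mulr0 mul0r.
  rewrite powRD ?normr_eq0 ?w0 ?implybT// powRr1// mulrA.
  by case: ltP => h; rewrite ?(ltr0_norm h) ?(ger0_norm h) ?mulN1r ?opprK ?mul1r.
have mpow (p : R) : measurable_fun [set: R] (fun w => `|w| `^ p).
  exact: (measurableT_comp (measurable_powR p) (@normr_measurable R setT)).
split.
  under eq_fun do rewrite cpow_iM//=.
  by apply: measurable_funM => //; exact: mpow.
have ImE w : Imz (cpow ('i%C * w%:C) (1 + alpha)) =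
    w * `|w| `^ alpha * sin ((1 + alpha) * (pi / 2)).
  by rewrite cpow_iM//= -E -[RHS]mulrA.
under eq_fun do rewrite ImE.
by apply: measurable_funM => //; apply: measurable_funM => //; exact: mpow.
Qed.

Lemma cmeasurable_limit_integrand n nu :
  cmeasurable (limit_integrand alpha tau n nu).
Proof.
apply: cmeasurable_expfam.
- exact/cmeasurableX/cmeasurable_limit_slope.
- exact: cmeasurable_limit_phase.
- exact: cmeasurable_limit_slope.
Qed.

Let cvgy_shift (T : R) : (T + k%:R) @[k --> \oo] --> +oo.
Proof.
apply/cvgryPge => A; near=> k.
rewrite -lerBlDl; near: k; exact: nbhs_infty_ger.
Unshelve. all: end_near. Qed.

(** The bound is inherited: for fixed [nu] the integrands at time t obey it for large t with a
    constant free of t and [nu], and it passes to the pointwise limit. No direct estimate of (i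
    w)^(1+alpha) is made. *)
Lemma limit_integrand_bound n : exists2 C : R, 0 <= C &
  forall nu w, normc (limit_integrand alpha tau n nu w) <= C * (1 + w ^+ 2)^-1.
Proof.
have /andP[a0 a1] := halpha.
have [C C0 hC] := kernel_integrand_bound halpha htau n.
(* The extra 1 covers w = 0, where the limit argument does not apply and the integrand is 0 ^+ n. *)
exists (C + 1); first by rewrite addr_ge0.
move=> nu w; have [->|w0] := eqVneq w 0.
  rewrite /limit_integrand /expfam /limit_phase /limit_slope !mulr0 oppr0 mul0r addr0.
  rewrite /cpow eqxx gt_eqF ?addr_gt0// mulr0 cexp0 mulr1.
  rewrite [0 ^+ 2]expr0n addr0 invr1 mulr1 normcX ComplexField.Normc.normc0 expr0n.
  by case: (n == 0%N); rewrite ?lerDr ?addr_ge0.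
have d0 : 0 <= (1 + w ^+ 2)^-1 by rewrite invr_ge0 addr_ge0// sqr_ge0.
apply: le_trans (_ : C * (1 + w ^+ 2)^-1 <= _); last first.
  by rewrite ler_wpM2r// lerDl.
have [T T1 hT] := large_time_threshold `|nu|.
pose u k := T + k%:R.
have Tu k : T <= u k by rewrite lerDl.
have u1 k : 1 <= u k := le_trans T1 (Tu k).
have c : normc (kernel_integrand alpha tau n (u k) nu w) @[k --> \oo] -->
    normc (limit_integrand alpha tau n nu w).
  apply: cvg_normc; exact: (ccvg_kernel_integrand_pinfty halpha htau u1 (cvgy_shift T)).
rewrite -(cvg_lim (@norm_hausdorff _ _) c); apply: limr_le; first exact: cvgP c.
apply: nearW => k; apply: hC => //; exact/ltW/hT.
Qed.

Definition limit_integral n nu : R :=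
  (4 * pi)^-1 * (\int[mu]_w Rez (limit_integrand alpha tau n nu w))%R.

Lemma cvg_kernel_integral n nu :
  kernel_integral alpha tau n t nu @[t --> +oo] --> limit_integral n nu.
Proof.
have [C C0 hC] := kernel_integrand_bound halpha htau n.
have [T T1 hT] := large_time_threshold `|nu|.
apply: (cvg_pinfty_threshold (T := T)) => u Tu uy.
have u1 k : 1 <= u k := le_trans T1 (Tu k).
apply: cvgM; first exact: cvg_cst.
apply: (dominated_cvg_Rintegral (g := fun w => C * (1 + w ^+ 2)^-1)).
- by move=> k; case: (cmeasurable_kernel_integrand halpha htau n nu (u1 k)).
- by case: (cmeasurable_limit_integrand n nu).
- move=> w w0; by case: (ccvg_kernel_integrand_pinfty halpha htau u1 uy w0 n nu).
- exact: integrable_scaled_inv1Dsqr.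
- move=> k w; apply: le_trans (abs_Re_le _) _; apply: hC => //; exact/ltW/hT.
Qed.

Lemma is_derive_limit_integral n nu :
  is_derive nu 1 (limit_integral n) (limit_integral n.+1 nu).
Proof.
have [C C0 hC] := limit_integrand_bound n.
have [C' C'0 hC'] := limit_integrand_bound n.+1.
have i0 (w : R) : 0 <= (1 + w ^+ 2)^-1 by rewrite invr_ge0 addr_ge0// sqr_ge0.
have pnu : nu - 1 < nu < nu + 1 by apply/andP; split; lra.
have E y w : expfam (fun w => limit_slope w ^+ n * limit_slope w)
    (limit_phase alpha tau) (@limit_slope R) y w = limit_integrand alpha tau n.+1 y w.
  by rewrite /limit_integrand /expfam exprSr.
have D : is_derive nu 1 (fun y => (\int[mu]_w Rez (limit_integrand alpha tau n y w))%R)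
   (\int[mu]_w Rez (limit_integrand alpha tau n.+1 nu w))%R.
  have -> : (\int[mu]_w Rez (limit_integrand alpha tau n.+1 nu w))%R =
    (\int[mu]_w Rez (expfam (fun w => limit_slope w ^+ n * limit_slope w)
      (limit_phase alpha tau) (@limit_slope R) nu w))%R.
    by apply: eq_Rintegral => w _; rewrite E.
  apply: (is_derive_Rintegral_expfam (p := nu - 1) (q := nu + 1)
     (g := fun w => (C + C') * (1 + w ^+ 2)^-1)) => //.
  - exact/cmeasurableX/cmeasurable_limit_slope.
  - exact: cmeasurable_limit_phase.
  - exact: cmeasurable_limit_slope.
  - exact: integrable_scaled_inv1Dsqr.
  - move=> y w _; apply: le_trans (hC _ _) _.
    by rewrite ler_wpM2r// lerDl.
  - move=> y w _; rewrite E; apply: le_trans (hC' _ _) _.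
    by rewrite ler_wpM2r// lerDr.
exact: is_deriveZ.
Qed.

Lemma limit_integrand0E nu w :
  limit_integrand alpha tau 0 nu w = kinf_integrand alpha tau nu w.
Proof.
rewrite /limit_integrand /expfam /kinf_integrand expr0 mul1r; congr cexp.
by rewrite /limit_phase /limit_slope rmorphM/=; ring.
Qed.

Lemma kinf_integrandN nu w : Imz (kinf_integrand alpha tau nu (- w)) =
  - Imz (kinf_integrand alpha tau nu w).
Proof.
have /andP[a0 a1] := halpha.
have p0 : 1 + alpha != 0 by rewrite gt_eqF// addr_gt0.
have [->|w0] := eqVneq w 0.
  rewrite oppr0 /kinf_integrand !mulr0 /cpow eqxx (negPf p0) mulr0 subr0 cexp0.
  by rewrite Im1 oppr0.
rewrite /kinf_integrand !Im_cexp !ReD !ImD !ReN !ImN !ReM !ImM !cpow_iM//= normrN.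
have -> : (if - w < 0 then -1 else 1) = - (if w < 0 then -1 else 1) :> R.
  by rewrite oppr_lt0; case: ltgtP w0; rewrite ?opprK// => ->; rewrite eqxx.
move: (if w < 0 then _ else _) (`|w| `^ _ * cos _) (`|w| `^ _ * sin _) => c x y.
rewrite -[RHS]mulrN -sinN; congr (expR _ * sin _); first by ring.
by ring.
Qed.

Lemma cintegrable_kinf_integrand nu :
  cintegrable [set: R] (kinf_integrand alpha tau nu).
Proof.
have [C C0 hC] := limit_integrand_bound 0.
have E : limit_integrand alpha tau 0 nu = kinf_integrand alpha tau nu.
  by apply/funext => w; exact: limit_integrand0E.
split; rewrite -E.
  apply: integrable_Re_dominated (integrable_scaled_inv1Dsqr C) => //.
  exact: cmeasurable_limit_integrand.
apply: integrable_Im_dominated (integrable_scaled_inv1Dsqr C) => //.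
exact: cmeasurable_limit_integrand.
Qed.

(** The complex integral is real because the imaginary part of the integrand is odd in [w]. *)
Lemma limit_integral0E nu : (limit_integral 0 nu)%:C =
  ((4 * pi)^-1)%:C * cintegral [set: R] (kinf_integrand alpha tau nu).
Proof.
have [iRe iIm] := cintegrable_kinf_integrand nu.
have I0 : (\int[mu]_w Imz (kinf_integrand alpha tau nu w))%R = 0.
  have := RintegralN iIm.
  under eq_Rintegral => w _ do rewrite kinf_integrandN -mulN1r.
  by rewrite RintegralZl//; lra.
rewrite /cintegral I0 complexr0 -rmorphM /limit_integral; congr ((_ * _)%:C).
by apply: eq_Rintegral => w _; rewrite limit_integrand0E.
Qed.

End LimitIntegral.

(** * Inversion of the Laplace transform *)

Section LaplaceInversion.
Variables (R : realType) (alpha tau : R).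
Hypotheses (halpha : 0 < alpha < 1) (htau : 0 < tau < 1).
Variable S : R -> R -> R.
Hypothesis hS : zener_fundamental_solution alpha tau S.
Local Notation mu := (@lebesgue_measure R).
Local Notation beta := (1 / (1 + alpha)).

Implicit Types (u w y : R).

Variables t x : R.
Hypotheses (t1 : 1 <= t) (xt : t / 2 <= x).

Let t0 : 0 < t. Proof. exact: lt_le_trans t1. Qed.
Let x0 : 0 < x. Proof. by apply: lt_le_trans xt; rewrite divr_gt0. Qed.
Let a := t ^- 2.
Let lam := t `^ (- beta).
Let s w := contour alpha t w.
Let l w := contour_l alpha tau t w.

Let a0 : 0 < a. Proof. by rewrite invr_gt0 exprn_gt0. Qed.
Let lam0 : 0 < lam. Proof. exact: powR_gt0. Qed.

(** With [bromwich_phase], this presents [zener_Stilde] times exp(s y) as an [expfam] in the time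
    [y], whose slope is the contour point s itself. *)
Definition bromwich_coef w : R[i] := (2%:R * contour alpha t w)^-1 * contour_l alpha tau t w.
Definition bromwich_phase w : R[i] :=
  - (x%:C * contour alpha t w * contour_l alpha tau t w).

Let StildeE (y w : R) : zener_Stilde alpha tau x (s w) * cexp (s w * y%:C) =
  expfam bromwich_coef bromwich_phase (contour alpha t) y w.
Proof.
rewrite /zener_Stilde gtr0_norm// /expfam cexpD /bromwich_coef /bromwich_phase.
by rewrite !mulrA.
Qed.

(** The function to which cosine inversion applies. Its integrability is the Laplace hypothesis at
    the real point of the contour, w = 0, and it vanishes for u < 0, so half-line integrals are
    integrals over the line. *)
Let damped u := S x u * expR (- (a * u)).

Let S_lt0 u : u < 0 -> S x u = 0.
Proof. by case: hS => h _ _; exact: h. Qed.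

Let Re_laplace w u : Rez ((S x u)%:C * cexp (- (s w * u%:C))) =
  damped u * cos (lam * w * u).
Proof.
rewrite ReM Re_cexp Im_cexp ReN ImN ReM ImM /= !mulr0 !mul0r !subr0 add0r cosN.
by rewrite mulrA.
Qed.

Let Im_laplace w u : Imz ((S x u)%:C * cexp (- (s w * u%:C))) =
  - (damped u * sin (lam * w * u)).
Proof.
rewrite ImM Re_cexp Im_cexp ReN ImN ReM ImM /= !mulr0 !mul0r !subr0 add0r addr0 sinN.
by rewrite !mulrN mulrA.
Qed.

Let restrictE (h : R -> R) :
  (fun u => damped u * h u) \_ `[0, +oo[ = fun u => damped u * h u.
Proof.
apply/funext => u; rewrite patchE; case: ifPn => //.
rewrite mem_setE in_itv/= andbT -ltNge => u0.
by rewrite /damped S_lt0// !mul0r.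
Qed.

Let mpos : measurable (`[0, +oo[ : set (measurableTypeR R)).
Proof. exact: measurable_itv. Qed.

Let laplace w := let: And3 _ h _ := hS in h x (s w) (Re_contour_gt0 alpha w t1).

Let integrable_cos w :
  mu.-integrable [set: R] (EFin \o (fun u => damped u * cos (lam * w * u))).
Proof.
have [[h _] _] := laplace w.
rewrite -restrictE -restrict_EFin; apply: (integrable_mkcond _ mpos).1.
by apply: eq_integrable h => // u _; exact: (congr1 EFin (Re_laplace w u)).
Qed.

Let integrable_sin w :
  mu.-integrable [set: R] (EFin \o (fun u => damped u * sin (lam * w * u))).
Proof.
have [[_ h] _] := laplace w.
rewrite -restrictE -restrict_EFin; apply: (integrable_mkcond _ mpos).1.
have := integrableN h; apply: eq_integrable => [//|u _].
have e : - Imz ((S x u)%:C * cexp (- (s w * u%:C))) = damped u * sin (lam * w * u).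
  by rewrite Im_laplace opprK.
exact: (congr1 EFin e).
Qed.

Let integral_half_line (h : R -> R) : (\int[mu]_u (damped u * h u))%R =
  (\int[mu]_(u in `[0, +oo[) (damped u * h u))%R.
Proof. by rewrite [RHS]Rintegral_mkcond restrictE. Qed.

Let integral_cos w : (\int[mu]_u (damped u * cos (lam * w * u)))%R =
  Rez (zener_Stilde alpha tau x (s w)).
Proof.
have [_ <-] := laplace w; rewrite integral_half_line.
by apply: eq_Rintegral => u _; rewrite -Re_laplace.
Qed.

Let integral_sin w : (\int[mu]_u (damped u * sin (lam * w * u)))%R =
  - Imz (zener_Stilde alpha tau x (s w)).
Proof.
have [[_ h] <-] := laplace w; rewrite integral_half_line.
rewrite -[RHS]mulN1r -[RHS]RintegralZl//.
by apply: eq_Rintegral => u _; rewrite mulN1r Im_laplace opprK.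
Qed.

Let integrable_damped : mu.-integrable [set: R] (EFin \o damped).
Proof.
apply: eq_integrable (integrable_cos 0) => // u _.
by rewrite /= mulr0 mul0r cos0 mulr1.
Qed.

(** Expanding cos(lam w (y - u)) combines the cosine and sine transforms into the real part of the
    Laplace transform times exp(i lam w y); the factor exp(- a y) compensates for the modulus of
    exp(s y). *)
Let cosine_transform y w : (\int[mu]_u (damped u * cos (lam * w * (y - u))))%R =
  expR (- (a * y)) * Rez (expfam bromwich_coef bromwich_phase (contour alpha t) y w).
Proof.
have E u : damped u * cos (lam * w * (y - u)) =
    cos (lam * w * y) * (damped u * cos (lam * w * u)) +
    sin (lam * w * y) * (damped u * sin (lam * w * u)).
  by rewrite mulrBr cosB; ring.
under eq_Rintegral => u _ do rewrite E.
have iZ (h : R -> R) (k : R) : mu.-integrable [set: R] (EFin \o h) ->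
    mu.-integrable [set: R] (EFin \o (fun u => k * h u)).
  by move=> hi; exact: integrableZl hi.
rewrite RintegralD//; [|exact/iZ/integrable_cos|exact/iZ/integrable_sin].
rewrite !RintegralZl// integral_cos integral_sin.
have Rs : Rez (s w * y%:C) = a * y by rewrite ReM /= mulr0 subr0.
have Is : Imz (s w * y%:C) = lam * w * y by rewrite ImM /= mulr0 add0r.
rewrite -StildeE; move: (zener_Stilde _ _ _ _) => F.
rewrite [Rez (_ * cexp _)]ReM Re_cexp Im_cexp Rs Is.
move: (Rez F) (Imz F) => X Y.
have ee : expR (- (a * y)) * expR (a * y) = 1 by rewrite -expRD addNr expR0.
transitivity ((expR (- (a * y)) * expR (a * y)) *
   (cos (lam * w * y) * X - sin (lam * w * y) * Y)); first by rewrite ee; ring.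
ring.
Qed.

(** Here [t] is fixed, so uniformity is not at stake: t^2 bounds |1 / (2 s)| for the integrand and 1
    bounds its time derivative, where 1 / s has cancelled. *)
Let bound w := (t ^+ 2 + 1) * (expR 2 * decay alpha tau w).

Let normc_cexp_bromwich y w : y < t + 1 ->
  normc (cexp (bromwich_phase w + contour alpha t w * y%:C)) <=
  expR 2 * decay alpha tau w.
Proof.
move=> yt; rewrite normc_cexp ReD expRD mulrC.
apply: ler_pM; rewrite ?expR_ge0//; last first.
  rewrite /bromwich_phase ReN -mulrA [Rez (x%:C * _)]ReM [Rez x%:C]/= [Imz x%:C]/= mul0r subr0.
  exact: expR_zener_l_le_decay.
rewrite ler_expR ReM /= mulr0 subr0 -/a.
(* From y < t + 1 <= 2 t one gets a y <= 2 / t <= 2, which explains the [expR 2] of the bound. *)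
apply: le_trans (_ : a * (2 * t) <= _).
  apply: ler_wpM2l; first exact: ltW.
  by apply: ltW; apply: lt_le_trans yt _; rewrite mulr_natl mulr2n lerD2l.
rewrite mulrCA ler_piMr// ler_pdivrMl ?exprn_gt0// mulr1 expr2.
by rewrite ler_peMl// ltW.
Qed.

Let bromwich_bound0 y w : y < t + 1 ->
  normc (expfam bromwich_coef bromwich_phase (contour alpha t) y w) <= bound w.
Proof.
move=> yt; rewrite /expfam normcM.
apply: ler_pM; rewrite ?normc_ge0// ?normc_cexp_bromwich//.
apply: le_trans (_ : t ^+ 2 <= _); last by rewrite lerDl.
rewrite /bromwich_coef normcM -[leRHS]mulr1; apply: ler_pM; rewrite ?normc_ge0//.
  rewrite ComplexField.Normc.normcV -[t ^+ 2]invrK lef_pV2 ?posrE -/a//.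
    rewrite normcM; apply: le_trans (_ : 1 * normc (contour alpha t w) <= _).
      rewrite mul1r; apply: le_trans (abs_Re_le _).
      by rewrite [Rez _]/= -/a ger0_norm// ltW.
    rewrite ler_wpM2r ?normc_ge0//.
    rewrite -[2%:R](rmorph_nat (real_complex R)) normcR ger0_norm//; lra.
  by rewrite normc_gt0 mulf_neq0// ?pnatr_eq0// contour_neq0.
exact: normc_contour_l_le1.
Qed.

Let coef_slopeE w : bromwich_coef w * contour alpha t w = 2%:R^-1 * l w.
Proof.
by rewrite /bromwich_coef mulrAC invfM -[_^-1 * _^-1 * _]mulrA mulVf ?contour_neq0// mulr1.
Qed.

Let bromwich_bound1 y w : y < t + 1 ->
  normc (expfam (fun w => bromwich_coef w * contour alpha t w)
    bromwich_phase (contour alpha t) y w) <= bound w.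
Proof.
move=> yt; rewrite /expfam normcM coef_slopeE.
apply: ler_pM; rewrite ?normc_ge0// ?normc_cexp_bromwich//.
apply: le_trans (_ : 1 * 1 <= _); last by rewrite mul1r lerDr exprn_ge0// ltW.
rewrite normcM; apply: ler_pM; rewrite ?normc_ge0//; last exact: normc_contour_l_le1.
rewrite ComplexField.Normc.normcV -[2%:R](rmorph_nat (real_complex R)) normcR.
by rewrite ger0_norm// invf_le1//; lra.
Qed.

Let cmeasurable_bromwich_coef : cmeasurable bromwich_coef.
Proof.
apply: cmeasurable_continuous => w; apply: ccvgM; last exact: ccvg_contour_l.
apply: ccvgV; first by rewrite mulf_neq0// ?pnatr_eq0// contour_neq0.
by apply: ccvgM; [exact: ccvg_cst|exact: ccvg_contour].
Qed.

Let cmeasurable_bromwich_phase : cmeasurable bromwich_phase.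
Proof.
apply: cmeasurable_continuous => w; apply: ccvgN; apply: ccvgM; last exact: ccvg_contour_l.
by apply: ccvgM; [exact: ccvg_cst|exact: ccvg_contour].
Qed.

Let integrable_bound : mu.-integrable [set: R] (EFin \o bound).
Proof.
have [C C0 hC] := decay_polynomial halpha htau 0.
pose K := (t ^+ 2 + 1) * expR 2.
have K0 : 0 <= K by rewrite mulr_ge0 ?expR_ge0// addr_ge0// exprn_ge0// ltW.
apply: integrable_dominated (integrable_scaled_inv1Dsqr (K * C)).
  apply: measurable_funM => //; apply: measurable_funM => //.
  rewrite /decay; apply: measurableT_comp => //; apply: measurable_funM => //.
  apply: measurable_funB => //.
  exact: (measurableT_comp (measurable_powR (1 - alpha)) (@normr_measurable R setT)).
move=> w; rewrite ger0_norm; last first.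
  by rewrite mulr_ge0 ?addr_ge0 ?exprn_ge0 ?(ltW t0)// mulr_ge0 ?expR_ge0.
rewrite /bound mulrA -/K -[leRHS]mulrA; apply: ler_wpM2l => //.
by have := hC w; rewrite expr0 mul1r.
Qed.

(** The contour depends on [t] only, while the time [y] varies independently; the formula thus holds
    on a neighbourhood of [t] and can be differentiated at y = t. *)
Lemma fundamental_solution_bromwich y : y < t + 1 ->
  S x y = lam / (2 * pi) *
    (\int[mu]_w Rez (expfam bromwich_coef bromwich_phase (contour alpha t) y w))%R.
Proof.
move=> yt.
have iE : mu.-integrable [set: R] (EFin \o (fun w =>
    Rez (expfam bromwich_coef bromwich_phase (contour alpha t) y w))).
  apply: integrable_Re_dominated integrable_bound.
    by apply: cmeasurable_expfam => //; exact: cmeasurable_contour.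
  by move=> w; exact: bromwich_bound0.
have cg : {for y, continuous damped}.
  apply: cvgM.
    by case: hS => _ _ h; apply: h; rewrite gt_eqF.
  apply: continuous_comp; last exact: continuous_expR.
  by apply: cvgN; apply: cvgM; [exact: cvg_cst|exact: cvg_id].
have FE : (fun w => (\int[mu]_u (damped u * cos (lam * w * (y - u))))%R) =
   fun w => expR (- (a * y)) *
     Rez (expfam bromwich_coef bromwich_phase (contour alpha t) y w).
  by apply/funext => w; exact: cosine_transform.
have := @cosine_inversion R damped lam y integrable_damped lam0 cg.
rewrite FE => H.
have {}H := H (integrableZl measurableT _ iE).
rewrite RintegralZl// in H.
set J := (\int[mu]_w _)%R; rewrite -/J in H.
have pi0 : (pi : R) != 0 by rewrite gt_eqF// pi_gt0.
have ee : expR (a * y) * expR (- (a * y)) = 1 by rewrite -expRD subrr expR0.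
have -> : S x y = expR (a * y) * damped y by rewrite /damped mulrCA ee mulr1.
apply: (@mulfI _ (2 * pi)); first by rewrite mulf_neq0.
rewrite mulrCA -H.
rewrite (_ : _ * (lam * _) = expR (a * y) * expR (- (a * y)) * (lam * J)); last ring.
by rewrite ee mul1r mulrA mulrCA divff ?mulr1// mulf_neq0.
Qed.

Lemma zener_K_bromwich : zener_K S x t =
  lam / (2 * pi) * (\int[mu]_w Rez (expfam
    (fun w => bromwich_coef w * contour alpha t w) bromwich_phase (contour alpha t) t w))%R.
Proof.
pose J y := (\int[mu]_w Rez (expfam bromwich_coef bromwich_phase (contour alpha t) y w))%R.
have ttt : t - 1 < t < t + 1 by apply/andP; split; lra.
have D : is_derive t 1 J (\int[mu]_w Rez (expfam
    (fun w => bromwich_coef w * contour alpha t w) bromwich_phase (contour alpha t) t w))%R.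
  apply: (is_derive_Rintegral_expfam (p := t - 1) (q := t + 1) (g := bound)) => //.
  - exact: cmeasurable_contour.
  - by move=> y w /andP[_ yt]; exact: bromwich_bound0.
  - by move=> y w /andP[_ yt]; exact: bromwich_bound1.
have SE : \forall y \near t, S x y = lam / (2 * pi) * J y.
  near=> y; apply: fundamental_solution_bromwich.
  by near: y; apply: (cvgr_lt t (@cvg_id _ _)); lra.
rewrite /zener_K derive1E (near_eq_derive _ SE) ?oner_eq0//.
rewrite deriveZ; last exact: ex_derive.
by rewrite derive_val.
Unshelve. all: end_near. Qed.

Lemma Re_bromwich_integrand w : Rez (expfam
    (fun w => bromwich_coef w * contour alpha t w) bromwich_phase (contour alpha t) t w) =
  2^-1 * Rez (contour_l alpha tau t w * cexp (bromwich_phase w + contour alpha t w * t%:C)).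
Proof.
rewrite /expfam coef_slopeE -mulrA.
have -> : 2%:R^-1 = (2^-1)%:C :> R[i] by rewrite fmorphV rmorph_nat.
by rewrite [LHS]ReM [Rez _%:C]/= [Imz _%:C]/= mul0r subr0.
Qed.

End LaplaceInversion.

(** * Convergence *)

(** Equicontinuity is required only for large t, with a threshold depending on the point.
    Compactness of the set, in its near-covering form, makes the threshold uniform, and each point
    costs three errors of e / 3. *)
Lemma cvg_family_compact_equicontinuous (R : realType) (H : R -> R -> R) (h : R -> R) :
  continuous h -> (forall x, H t x @[t --> +oo] --> h x) ->
  (forall x e, 0 < e -> \forall y \near x & t \near +oo, `|H t y - H t x| < e) ->
  {family compact, H @ +oo --> h}.
Proof.
move=> ch Hh eqc; apply/fam_cvgP => A cA P /uniform_nbhs [E [entE EP]].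
move: entE; rewrite -entourage_ballE => -[e /= e0 eE].
have e3 : 0 < e / 3 by rewrite divr_gt0.
have N : \forall t \near +oo, A `<=` (fun y => `|h y - H t y| < e).
  apply: ((compact_near_coveringP A).1 cA) => x Ax.
  have h1 : \forall y \near x & t \near (pinfty_nbhs R), `|h x - h y| < e / 3.
    have c := (cvgrPdist_lt _ _).1 (ch x) _ e3; near=> y t; rewrite /=; near: y; exact: c.
  have h2 : \forall y \near x & t \near (pinfty_nbhs R), `|h x - H t x| < e / 3.
    have c := (cvgrPdist_lt _ _).1 (Hh x) _ e3; near=> y t; rewrite /=; near: t; exact: c.
  apply: filterS3 h1 h2 (eqc x _ e3) => -[y t] /= a1 a2 a3.
  have -> : h y - H t y = - (h x - h y) + (h x - H t x) - (H t y - H t x) by ring.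
  apply: le_lt_trans (ler_normB _ _) _; apply: le_lt_trans (lerD (ler_normD _ _) (lexx _)) _.
  by rewrite normrN; lra.
apply: filterS N => t AN; apply: EP => y Ay.
by apply: eE; exact: AN.
Unshelve. all: end_near. Qed.

(** * Identification of the rescaled kernel and locally uniform convergence *)

Section ZenerProfile.
Variables (R : realType) (alpha tau : R).
Hypotheses (halpha : 0 < alpha < 1) (htau : 0 < tau < 1).
Variable S : R -> R -> R.
Hypothesis hS : zener_fundamental_solution alpha tau S.
Implicit Types (t nu : R).
Local Notation mu := (@lebesgue_measure R).
Local Notation beta := (1 / (1 + alpha)).

Lemma zener_kE t nu : 1 <= t -> t / 2 <= t + nu * t `^ beta ->
  zener_k alpha S t nu = kernel_integral alpha tau 0 t nu.
Proof.
move=> t1 ht; have t0 : 0 < t by exact: lt_le_trans t1.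
set x := t + nu * t `^ beta.
have x0 : 0 <= x by apply: le_trans ht; rewrite divr_ge0// ltW.
have [C C0 hC] := kernel_integrand_bound halpha htau 0.
rewrite /zener_k /zener_Kplus /heaviside -/x x0.
rewrite (zener_K_bromwich halpha htau hS t1 ht).
have ii : mu.-integrable [set: R]
    (EFin \o (fun w => Rez (kernel_integrand alpha tau 0 t nu w))).
  apply: integrable_Re_dominated (integrable_scaled_inv1Dsqr C).
    exact: cmeasurable_kernel_integrand.
  by move=> w; exact: hC.
have E w : Rez (expfam (fun w => bromwich_coef alpha tau t w * contour alpha t w)
    (bromwich_phase alpha tau t x) (contour alpha t) t w) =
    2^-1 * Rez (kernel_integrand alpha tau 0 t nu w).
  rewrite Re_bromwich_integrand// /kernel_integrand /expfam expr0 mulr1 phase_slopeE -/x.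
  by rewrite /bromwich_phase addrC.
under eq_Rintegral => w _ do rewrite E.
rewrite RintegralZl// /kernel_integral.
set I := (\int[mu]_w _)%R.
have P : t `^ beta * t `^ (- beta) = 1.
  by rewrite -powRD ?subrr ?powRr0// (gt_eqF t0) implybT.
have -> : t `^ beta * (1 * (t `^ (- beta) / (2 * pi) * (2^-1 * I))) =
  t `^ beta * t `^ (- beta) * ((2 * pi)^-1 * 2^-1 * I) by ring.
rewrite P mul1r -invfM; congr (_^-1 * _); ring.
Qed.

Lemma near_admissible t nu : t / 2 < t + nu * t `^ beta ->
  \forall y \near nu, t / 2 < t + y * t `^ beta.
Proof.
move=> ht.
have c : t + y * t `^ beta @[y --> nu] --> t + nu * t `^ beta.
  apply: cvgD; first exact: cvg_cst.
  by apply: cvgM; [exact: cvg_id|exact: cvg_cst].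
exact: cvgr_gt c _ ht.
Qed.

(** The two sides are identified only where x > t / 2. That set is open in [nu], so equality at
    order n holds near each of its points and passes to order n + 1. *)
Lemma derive1n_zener_k n t nu : 1 <= t -> t / 2 < t + nu * t `^ beta ->
  (zener_k alpha S t)^`(n) nu = kernel_integral alpha tau n t nu.
Proof.
move=> t1; elim: n nu => [|n IH] nu ht.
  by rewrite derive1n0 zener_kE// ltW.
have D := is_derive_kernel_integral halpha htau n t1 ht.
rewrite derive1nS derive1E -(@derive_val _ _ _ _ _ _ _ D).
apply: near_eq_derive; have := near_admissible ht.
by apply: filterS => y; exact: IH.
Qed.

Lemma derivable_derive1n_zener_k n t nu : 1 <= t -> t / 2 < t + nu * t `^ beta ->
  derivable ((zener_k alpha S t)^`(n)) nu 1.
Proof.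
move=> t1 ht.
have D := is_derive_kernel_integral halpha htau n t1 ht.
apply: near_eq_derivable (@ex_derive _ _ _ _ _ _ _ D).
have := near_admissible ht.
by apply: filterS => y hy; rewrite derive1n_zener_k.
Qed.

Lemma derive1n_limit_integral n : (limit_integral alpha tau 0)^`(n) =
  limit_integral alpha tau n.
Proof.
elim: n => [|n IH]; first by rewrite derive1n0.
rewrite derive1nS IH; apply/funext => nu; rewrite derive1E.
exact: (@derive_val _ _ _ _ _ _ _ (is_derive_limit_integral halpha htau n nu)).
Qed.

Lemma continuous_limit_integral n : continuous (limit_integral alpha tau n).
Proof.
move=> nu; apply: differentiable_continuous; apply/derivable1_diffP.
exact: (@ex_derive _ _ _ _ _ _ _ (is_derive_limit_integral halpha htau n nu)).
Qed.

(** The constant is the uniform bound on the derivative of order n + 1, through the mean value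
    theorem. It does not depend on [M], which affects only the threshold. *)
Lemma kernel_integral_lipschitz n : exists2 L : R, 0 <= L & forall M : R,
  exists T : R, forall t x y, T <= t -> `|x| <= M -> `|y| <= M ->
  `|kernel_integral alpha tau n t y - kernel_integral alpha tau n t x| <= L * `|y - x|.
Proof.
have [L L0 hL] := kernel_integral_bound halpha htau n.+1.
exists L => // M; have [T T1 hT] := large_time_threshold halpha M.
exists T => t x y Tt; have t1 := le_trans T1 Tt.
wlog xy : x y / x < y.
  move=> W xM yM; have [xy|yx|->] := ltgtP x y; first exact: W.
    by rewrite distrC [`|y - x|]distrC; exact: W.
  by rewrite !subrr normr0 mulr0.
move=> /ler_normlP[x1 x2] /ler_normlP[y1 y2].
have D z : x <= z <= y -> is_derive z 1 (kernel_integral alpha tau n t)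
    (kernel_integral alpha tau n.+1 t z).
  move=> /andP[xz zy]; apply: is_derive_kernel_integral => //; apply: hT => //.
  by rewrite ler_norml; apply/andP; split; lra.
have cf : {within `[x, y], continuous (kernel_integral alpha tau n t)}.
  apply: derivable_within_continuous => z; rewrite in_itv/= => /D Dz.
  exact: (@ex_derive _ _ _ _ _ _ _ Dz).
have Doo z : z \in `]x, y[%R -> is_derive z 1 (kernel_integral alpha tau n t)
    (kernel_integral alpha tau n.+1 t z).
  by rewrite in_itv/= => /andP[xz zy]; apply: D; rewrite !ltW.
have [z zI ->] := MVT xy Doo cf.
rewrite normrM ler_wpM2r//; apply: hL => //; apply/ltW/hT => //.
move: zI; rewrite in_itv/= => /andP[xz zy].
by rewrite ler_norml; apply/andP; split; lra.
Qed.

Lemma cvg_family_derive1n_zener_k n :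
  {family compact, (fun t => (zener_k alpha S t)^`(n)) @ +oo --> limit_integral alpha tau n}.
Proof.
have near_eq (M : R) : \forall t \near (pinfty_nbhs R), forall nu, `|nu| <= M ->
    (zener_k alpha S t)^`(n) nu = kernel_integral alpha tau n t nu.
  have [T T1 hT] := large_time_threshold halpha M.
  near=> t => nu nuM; have Tt : T <= t by near: t; apply: nbhs_pinfty_ge; exact: num_real.
  apply: derive1n_zener_k.
    exact: le_trans T1 Tt.
  exact: hT.
apply: cvg_family_compact_equicontinuous.
- exact: continuous_limit_integral.
- move=> nu; have := @cvg_kernel_integral _ _ _ halpha htau n nu; apply: cvg_trans.
  apply: near_eq_cvg; have := near_eq `|nu|.
  by apply: filterS => t /(_ nu (lexx _)).
- move=> x e e0.
  have [L L0 hL] := kernel_integral_lipschitz n.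
  have [T hT] := hL (`|x| + 1).
  (* L + 1 replaces L as divisor, since L may be 0. *)
  have L1 : 0 < L + 1 by rewrite ltr_pwDr.
  have eL0 : 0 < e / (L + 1) by rewrite divr_gt0.
  have h1 : \forall y \near x & t \near (pinfty_nbhs R), `|x - y| < e / (L + 1).
    have c := (cvgrPdist_lt id x).1 (@cvg_id _ _) _ eL0; near=> y t; rewrite /=; near: y; exact: c.
  have h2 : \forall y \near x & t \near (pinfty_nbhs R), `|x - y| < 1.
    have c := (cvgrPdist_lt id x).1 (@cvg_id _ _) _ ltr01; near=> y t; rewrite /=; near: y; exact: c.
  have h3 : \forall y \near x & t \near (pinfty_nbhs R), T <= t /\ (forall nu, `|nu| <= `|x| + 1 ->
      (zener_k alpha S t)^`(n) nu = kernel_integral alpha tau n t nu).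
    have c := filterI (nbhs_pinfty_ge (num_real T)) (near_eq (`|x| + 1)).
    near=> y t; rewrite /=; near: t; exact: c.
  apply: filterS3 h1 h2 h3 => -[y t] /= a1 a2 [Tt eqk].
  have xM : `|x| <= `|x| + 1 by rewrite lerDl.
  have yM : `|y| <= `|x| + 1.
    rewrite (_ : y = x - (x - y)); last ring.
    by apply: le_trans (ler_normB _ _) _; rewrite lerD2l ltW.
  rewrite !eqk//; apply: le_lt_trans (hT _ _ _ Tt xM yM) _.
  rewrite distrC in a1.
  apply: le_lt_trans (_ : (L + 1) * `|y - x| < _); first by rewrite ler_wpM2r// lerDl.
  by rewrite mulrC -ltr_pdivlMr.
Unshelve. all: end_near. Qed.

End ZenerProfile.

Theorem theorem4p4 (R : realType) (alpha tau : R)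
    (halpha : 0 < alpha < 1) (htau : 0 < tau < 1)
    (S : R -> R -> R) (hS : zener_fundamental_solution alpha tau S) :
  exists kinf : R -> R,
    [/\ {family compact, (fun t : R => zener_k alpha S t) @ +oo --> kinf},
        forall nu : R,
          cintegrable [set: R] (kinf_integrand alpha tau nu) /\
          (kinf nu)%:C =
            ((4 * pi)^-1)%:C * cintegral [set: R] (kinf_integrand alpha tau nu)
      & forall n : nat,
          [/\ forall nu : R, derivable (kinf^`(n)) nu 1,
              forall A : set R, compact A ->
                \forall t \near +oo, forall nu : R, A nu ->
                  derivable ((zener_k alpha S t)^`(n)) nu 1
            & {family compact,
                (fun t : R => (zener_k alpha S t)^`(n)) @ +oo --> kinf^`(n)}]].
Proof.
exists (limit_integral alpha tau 0); split.
- exact: (@cvg_family_derive1n_zener_k _ _ _ halpha htau _ hS 0).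
- by move=> nu; split; [exact: cintegrable_kinf_integrand|exact: limit_integral0E].
move=> n; rewrite derive1n_limit_integral//; split.
- move=> nu.
  exact: (@ex_derive _ _ _ _ _ _ _ (is_derive_limit_integral halpha htau n nu)).
- move=> A /compact_bounded [M [_ hM]].
  (* The boundedness of [A] provides a bound by every number strictly above M, hence M + 1. *)
  have [T T1 hT] := large_time_threshold halpha (M + 1).
  near=> t => nu Anu; have Tt : T <= t by near: t; apply: nbhs_pinfty_ge; exact: num_real.
  apply: (derivable_derive1n_zener_k halpha htau hS); first exact: le_trans T1 Tt.
  by apply: hT => //; apply: hM => //; rewrite ltrDl.
- exact: cvg_family_derive1n_zener_k.
Unshelve. all: end_near. Qed.
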